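(* Let $(M,g)$ be a semi-Riemannian manifold of dimension $n\ge3$. Then $$g\big((P\cdot\mathcal P)(X_1,X_2,X_3,X,Y),X_4\big)=(P\cdot P)(X_1,X_2,X_3,X_4,X,Y)$$ holds for all vector fields $X_1,X_2,X_3,X_4,X,Y$ on $M$ if and only if $M$ is Einstein.
   Context: $(M,g)$ is a connected smooth semi-Riemannian manifold of dimension $n\ge 3$; $R$ is the $(0,4)$ Riemann curvature tensor, with the sign convention that the Ricci tensor $S(X_2,X_3)$ is the $g$-trace of $R(X_1,X_2,X_3,X_4)$ over $X_1,X_4$; $\kappa$ is the scalar curvature. Einstein means $S=\frac{\kappa}{n}g$. Projective curvature tensor: $P(X_1,X_2,X_3,X_4)=R(X_1,X_2,X_3,X_4)-\frac{1}{n-1}\left[S(X_2,X_3)g(X_1,X_4)-S(X_1,X_3)g(X_2,X_4)\right]$, with $(1,3)$-version $\mathcal P$ given by $g(\mathcal P(X,Y)X_1,X_2)=P(X,Y,X_1,X_2)$. For a $(0,4)$-tensor $H$, $(P\cdot H)(X_1,\dots,X_4,X,Y)=-\sum_{i=1}^4H(X_1,\dots,\mathcal P(X,Y)X_i,\dots,X_4)$. For a $(1,3)$-tensor $\mathcal H$, $$(P\cdot\mathcal H)(X_1,X_2,X_3,X,Y)=\mathcal P(X,Y)\mathcal H(X_1,X_2,X_3)-\mathcal H(\mathcal P(X,Y)X_1,X_2,X_3)-\mathcal H(X_1,\mathcal P(X,Y)X_2,X_3)-\mathcal H(X_1,X_2,\mathcal P(X,Y)X_3),$$ where $\mathcal P(X_1,X_2,X_3)=\mathcal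 P(X_1,X_2)X_3$. *)

(* Defs.v *)
From HB Require Import structures.
From mathcomp Require Import all_boot all_order all_algebra.
From mathcomp Require Import all_classical all_reals all_analysis.

Set Implicit Arguments.
Unset Strict Implicit.
Unset Printing Implicit Defensive.

Import Order.TTheory GRing.Theory Num.Theory.
Import numFieldNormedType.Exports.

Local Open Scope classical_set_scope.
Local Open Scope ring_scope.

(* C^k and C^oo maps on an open subset of R^n.  Asking for Fréchet
   differentiability at each stage is harmless: a map with continuous partial
   derivatives is differentiable.  The stage k = 0 is continuity, so C^k has
   continuous derivatives of order k. *)
Fixpoint Ck_on (R : realType) (n : nat) (W : normedModType R) (k : nat)
    (U : set 'rV[R]_n) (f : 'rV[R]_n -> W) : Prop :=
  match k with
  | 0%N => forall x, U x -> {for x, continuous f}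
  | k'.+1 => (forall x, U x -> differentiable f x) /\
             (forall v, Ck_on k' U ('D_v f))
  end.

Definition smooth_on (R : realType) (n : nat) (W : normedModType R)
    (U : set 'rV[R]_n) (f : 'rV[R]_n -> W) : Prop :=
  forall k, Ck_on k U f.

(* [chart_coord] and [chart_param] are total functions whose values matter only on
   [chart_dom] and on its image; there they are inverse homeomorphisms. *)
Record chart (R : realType) (n : nat) (M : topologicalType) := Chart {
  chart_dom : set M;
  chart_coord : M -> 'rV[R]_n;
  chart_param : 'rV[R]_n -> M;
  chart_dom_open : open chart_dom;
  chart_image_open : open (chart_coord @` chart_dom);
  chart_coord_continuous : forall p, chart_dom p -> {for p, continuous chart_coord};
  chart_param_continuous :
    forall x, (chart_coord @` chart_dom) x -> {for x, continuous chart_param};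
  chart_coordK : forall p, chart_dom p -> chart_param (chart_coord p) = p
}.

Definition transition (R : realType) (n : nat) (M : topologicalType)
    (c d : chart R n M) : 'rV[R]_n -> 'rV[R]_n := chart_coord d \o chart_param c.

Record smooth_manifold (R : realType) (n : nat) := SmoothManifold {
  manifold_sort :> topologicalType;
  manifold_hausdorff : hausdorff_space manifold_sort;
  manifold_second_countable : @second_countable manifold_sort;
  atlas : set (chart R n manifold_sort);
  atlas_cover : forall p, exists2 c, atlas c & chart_dom c p;
  atlas_compatible : forall c d, atlas c -> atlas d ->
    smooth_on (chart_coord c @` (chart_dom c `&` chart_dom d)) (transition c d)
}.

(* With row vectors, components change by  v_d = v_c *m jac c d p. *)
Definition jac (R : realType) (n : nat) (M : topologicalType)
    (c d : chart R n M) (p : M) : 'M[R]_n :=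
  'J (transition c d) (chart_coord c p).

(* Vector fields and the metric are given by their components in every chart
   of the atlas, viewed as functions of the point and subject to the
   transformation law; the values at charts outside the atlas, or at points
   outside [chart_dom], are junk. *)
Record vector_field (R : realType) (n : nat) (M : smooth_manifold R n) :=
  VectorField {
  vf_comp :> chart R n M -> M -> 'rV[R]_n;
  vf_smooth : forall c, atlas c ->
    smooth_on (chart_coord c @` chart_dom c) (vf_comp c \o chart_param c);
  vf_change : forall c d, atlas c -> atlas d ->
    forall p, chart_dom c p -> chart_dom d p ->
    vf_comp d p = vf_comp c p *m jac c d p
}.

(* A metric of arbitrary signature: symmetric and nondegenerate.  The index
   is locally constant, hence constant on a connected manifold. *)
Record semi_riemannian_metric (R : realType) (n : nat)
    (M : smooth_manifold R n) := SemiRiemannianMetric {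
  metric_mx :> chart R n M -> M -> 'M[R]_n;
  metric_smooth : forall c, atlas c ->
    smooth_on (chart_coord c @` chart_dom c) (metric_mx c \o chart_param c);
  metric_sym : forall c, atlas c -> forall p, chart_dom c p ->
    (metric_mx c p)^T = metric_mx c p;
  metric_nondegenerate : forall c, atlas c -> forall p, chart_dom c p ->
    metric_mx c p \in unitmx;
  metric_change : forall c d, atlas c -> atlas d ->
    forall p, chart_dom c p -> chart_dom d p ->
    metric_mx c p = jac c d p *m metric_mx d p *m (jac c d p)^T
}.

Section Curvature.
Variables (R : realType) (n : nat) (M : smooth_manifold R n).
Variables (g : semi_riemannian_metric M) (c : chart R n M).

Definition basis_vec (i : 'I_n) : 'rV[R]_n := delta_mx 0 i.

Definition coord_deriv (i : 'I_n) (f : M -> R) (p : M) : R :=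
  'D_(basis_vec i) ((f : M -> R^o) \o chart_param c) (chart_coord c p).

Definition metric_at (p : M) (u v : 'rV[R]_n) : R :=
  (u *m g c p *m v^T) 0 0.

(* g^{ij} *)
Definition metric_inv (p : M) : 'M[R]_n := invmx (g c p).

(* Levi-Civita connection: nabla_{d_i} d_j = \sum_k Gamma^k_{ij} d_k. *)
Definition christoffel (i j k : 'I_n) (p : M) : R :=
  2^-1 * \sum_(l < n) metric_inv p k l *
    (coord_deriv i (fun q => g c q j l) p +
     coord_deriv j (fun q => g c q i l) p -
     coord_deriv l (fun q => g c q i j) p).

(* Component along d_l of
   nabla_{d_i} nabla_{d_j} d_k - nabla_{d_j} nabla_{d_i} d_k. *)
Definition riemann_up (i j k l : 'I_n) (p : M) : R :=
  coord_deriv i (christoffel j k l) p - coord_deriv j (christoffel i k l) p +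
  \sum_(m < n) (christoffel i m l p * christoffel j k m p -
                christoffel j m l p * christoffel i k m p).

Definition riemann_down (i j k l : 'I_n) (p : M) : R :=
  \sum_(m < n) riemann_up i j k m p * g c p m l.

(* From here on, tensor fields are evaluated at [p] on vectors given by their
   components in [c]. *)
Definition riemann (p : M) (X1 X2 X3 X4 : 'rV[R]_n) : R :=
  \sum_(i < n) \sum_(j < n) \sum_(k < n) \sum_(l < n)
    riemann_down i j k l p * X1 0 i * X2 0 j * X3 0 k * X4 0 l.

Definition ricci (p : M) (X2 X3 : 'rV[R]_n) : R :=
  \sum_(a < n) \sum_(b < n)
    metric_inv p a b * riemann p (basis_vec a) X2 X3 (basis_vec b).

Definition scalar_curvature (p : M) : R :=
  \sum_(a < n) \sum_(b < n)
    metric_inv p a b * ricci p (basis_vec a) (basis_vec b).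

Definition projective (p : M) (X1 X2 X3 X4 : 'rV[R]_n) : R :=
  riemann p X1 X2 X3 X4 -
  (n%:R - 1)^-1 * (ricci p X2 X3 * metric_at p X1 X4 -
                   ricci p X1 X3 * metric_at p X2 X4).

(* The (1,3)-version: raise the last index of [projective]. *)
Definition projective_op (p : M) (X Y Z : 'rV[R]_n) : 'rV[R]_n :=
  (\row_(l < n) projective p X Y Z (basis_vec l)) *m metric_inv p.

Definition projective_dot04
    (H : 'rV[R]_n -> 'rV[R]_n -> 'rV[R]_n -> 'rV[R]_n -> R) (p : M)
    (X1 X2 X3 X4 X Y : 'rV[R]_n) : R :=
  - (H (projective_op p X Y X1) X2 X3 X4 +
     H X1 (projective_op p X Y X2) X3 X4 +
     H X1 X2 (projective_op p X Y X3) X4 +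
     H X1 X2 X3 (projective_op p X Y X4)).

Definition projective_dot13
    (H : 'rV[R]_n -> 'rV[R]_n -> 'rV[R]_n -> 'rV[R]_n) (p : M)
    (X1 X2 X3 X Y : 'rV[R]_n) : 'rV[R]_n :=
  projective_op p X Y (H X1 X2 X3) -
  H (projective_op p X Y X1) X2 X3 -
  H X1 (projective_op p X Y X2) X3 -
  H X1 X2 (projective_op p X Y X3).

End Curvature.

Definition einstein (R : realType) (n : nat) (M : smooth_manifold R n)
    (g : semi_riemannian_metric M) : Prop :=
  forall c, atlas c -> forall p, chart_dom c p -> forall u v : 'rV[R]_n,
  ricci g c p u v = scalar_curvature g c p / n%:R * metric_at g c p u v.

(* [projective_op] is characterised by g(P(X,Y)Z, W) = P(X,Y,Z,W). *)
Lemma metric_projective_op (R : realType) (n : nat) (M : smooth_manifold R n)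
    (g : semi_riemannian_metric M) (c : chart R n M) (p : M)
    (X Y Z W : 'rV[R]_n) :
  atlas c -> chart_dom c p ->
  metric_at g c p (projective_op g c p X Y Z) W = projective g c p X Y Z W.
Proof.
move=> ac cp; rewrite {1}/metric_at /projective_op /metric_inv.
rewrite mulmxKV ?metric_nondegenerate// mxE.
under eq_bigr do rewrite [X in X * _]mxE [X in _ * X]mxE.
have mE (u v : 'rV[R]_n) :
    metric_at g c p u v = \sum_(l < n) (u *m g c p) 0 l * v 0 l.
  by rewrite /metric_at mxE; apply: eq_bigr => l _; rewrite [v^T _ _]mxE.
have dE (l k : 'I_n) : basis_vec R l 0 k = (k == l)%:R by rewrite mxE eqxx.
have bE (u : 'rV[R]_n) l : metric_at g c p u (basis_vec R l) = (u *m g c p) 0 l.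
  rewrite mE (bigD1 l)//= big1 ?addr0; last first.
    by move=> k /negPf kl; rewrite dE kl mulr0.
  by rewrite dE eqxx mulr1.
rewrite /projective.
have -> : riemann g c p X Y Z W =
    \sum_(l < n) riemann g c p X Y Z (basis_vec R l) * W 0 l.
  rewrite /riemann; under [RHS]eq_bigr do rewrite mulr_suml.
  rewrite [RHS]exchange_big; apply: eq_bigr => i _ /=.
  under [RHS]eq_bigr do rewrite mulr_suml.
  rewrite [RHS]exchange_big; apply: eq_bigr => j _ /=.
  under [RHS]eq_bigr do rewrite mulr_suml.
  rewrite [RHS]exchange_big; apply: eq_bigr => k _ /=.
  under [RHS]eq_bigr do rewrite mulr_suml.
  rewrite [RHS]exchange_big; apply: eq_bigr => l _ /=; rewrite (bigD1 l)//= big1 ?addr0; last first.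
    by move=> m /negPf ml; rewrite dE eq_sym ml mulr0 mul0r.
  by rewrite dE eqxx mulr1.
under eq_bigr do rewrite !bE mulrBl -mulrA mulrBl -!mulrA.
by rewrite sumrB -mulr_sumr sumrB -!mulr_sumr -!mE.
Qed.

(* Main.v *)
(** At each point put E = S - (kappa/n) g.  Since g(P(X1,X2)X3, Z) = P(X1,X2,X3,Z), the two
    sides differ by P(X,Y,V,W) + P(X,Y,W,V) with V = P(X1,X2)X3, which is a multiple of
    E(Y,V)g(X,W) - E(X,V)g(Y,W) + E(Y,W)g(X,V) - E(X,W)g(Y,V); so it vanishes if E = 0.

    Conversely, tracing over X and W gives E(Y,V) = 0, whence
    E(Y,W) P(X1,X2,X3,X) = E(X,W) P(X1,X2,X3,Y).  The trace of P over slots 1 and 4 is 0, and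
    over slots 2 and 3 it is n/(n-1) E.  Writing g(eW, X) = E(X,W), the trace over X1 and X
    yields P(eW,X2,X3,Y) = 0, and a further trace over X2 and X3 yields E(eW,Y) = 0.  In
    indefinite signature the latter does not force E = 0, but
    P(eZ,Z,Z,Z) = -(E(Z,Z)g(eZ,Z) - E(eZ,Z)g(Z,Z))/(n-1) = -E(Z,Z)^2/(n-1) does.

    Bump functions realise arbitrary tangent vectors by global vector fields, and the
    symmetry of second derivatives gives the skewness of R in its last two slots and
    its pair symmetry. *)

Require Import Defs.
From mathcomp Require Import all_boot all_order all_algebra.
From mathcomp Require Import all_classical all_reals all_analysis.
From mathcomp Require Import ring.

Set Implicit Arguments.
Unset Strict Implicit.
Unset Printing Implicit Defensive.

Import Order.TTheory GRing.Theory Num.Theory.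
Import numFieldNormedType.Exports.

Local Open Scope classical_set_scope.
Local Open Scope ring_scope.

(** * Calculus of C^k maps on open sets *)

(** The first-order expansion of [f] at [x] is also one of [h], so by uniqueness ['d f x] is the
    differential of [h]. *)
Lemma near_eq_differentiable (R : realType) (V W : normedModType R)
    (f h : V -> W) (x : V) :
  (\near x, f x = h x) -> differentiable f x -> differentiable h x.
Proof.
move=> fh df.
have hx : f x = h x by exact: nbhs_singleton fh.
have dfh : h \o shift x = cst (h x) + 'd f x +o_ 0 id.
  have /eqaddoP fo := diff_locally df.
  have nfh : \forall y \near 0, f (y + x) = h (y + x).
    by have := fh; rewrite (near_shift 0) subr0.
  apply/eqaddoP => e e0; near=> y.
  have -> : (h \o shift x - (cst (h x) + 'd f x)) y =
            (f \o shift x - (cst (f x) + 'd f x)) y.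
    by rewrite !fctE /= hx; congr (_ - _); apply/esym; near: y.
  by near: y; exact: fo.
apply/diff_locallyP; rewrite (diff_unique _ dfh); last exact: diff_continuous.
by split=> //; exact: diff_continuous.
Unshelve. all: by end_near. Qed.

Section CkOn.
Context {R : realType} {n : nat}.
Implicit Types (W : normedModType R) (U V : set 'rV[R]_n) (f h : 'rV[R]_n -> R^o).

Lemma Ck_on_subset W k U V (f : 'rV[R]_n -> W) :
  V `<=` U -> Ck_on k U f -> Ck_on k V f.
Proof.
move=> VU; elim: k f => [|k IH] f /= => [fU x /VU/fU //|[df Df]].
by split=> [x /VU/df//|v]; exact/IH/Df.
Qed.

Lemma Ck_on_setU W k U V (f : 'rV[R]_n -> W) :
  Ck_on k U f -> Ck_on k V f -> Ck_on k (U `|` V) f.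
Proof.
elim: k f => [|k IH] f /= => [fU fV x [/fU|/fV]//|[dU DU] [dV DV]].
by split=> [x [/dU|/dV]//|v]; exact: IH.
Qed.

(** As [U] is open, [f] and [h] agree near each of its points; hence their derivatives agree on [U]
    too, and the induction continues. *)
Lemma eq_Ck_on W k U (f h : 'rV[R]_n -> W) : open U ->
  (forall x, U x -> f x = h x) -> Ck_on k U f -> Ck_on k U h.
Proof.
move=> oU; elim: k f h => [|k IH] f h fh /=.
  move=> cf x Ux; have ffh : {near x, f =1 h}.
    by have := open_nbhs_nbhs (conj oU Ux); apply: filterS => y /fh.
  rewrite /prop_for /continuous_at -(fh _ Ux).
  by apply: cvg_trans (near_eq_cvg ffh) _; exact: cf.
move=> [df Df].
have ffh x : U x -> {near x, f =1 h}.
  by move=> Ux; have := open_nbhs_nbhs (conj oU Ux); apply: filterS => y /fh.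
split=> [x Ux|v]; first exact: near_eq_differentiable (ffh x Ux) (df x Ux).
by apply: IH (Df v) => x Ux; apply: near_eq_derive; exact: ffh.
Qed.

Lemma Ck_onW W k U (f : 'rV[R]_n -> W) : Ck_on k.+1 U f -> Ck_on k U f.
Proof.
elim: k f => [|k IH] f [df Df].
  by move=> x /df; exact: differentiable_continuous.
by split=> // v; apply: IH; exact: Df.
Qed.

Lemma Ck_on_cst W k U (a : W) : Ck_on k U (cst a).
Proof.
elim: k a => [|k IH] a /= => [x _|]; first exact: cst_continuous.
split=> [x _|v]; first exact: differentiable_cst.
by rewrite (_ : 'D_v _ = cst 0) //; apply/funext => x; exact: derive_cst.
Qed.

Lemma Ck_onD k U f h : open U -> Ck_on k U f -> Ck_on k U h ->
  Ck_on k U (fun x => f x + h x : R^o).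
Proof.
move=> oU; elim: k f h => [|k IH] f h /=.
  by move=> cf ch x Ux; apply: (@continuousD _ _ _ f h); [exact: cf|exact: ch].
move=> [df Df] [dh Dh]; split=> [x Ux|v].
  by apply: (@differentiableD _ _ _ f h); [exact: df|exact: dh].
apply: eq_Ck_on (IH _ _ (Df v) (Dh v)) => // x Ux.
by rewrite -deriveD//; apply: diff_derivable; [exact: df|exact: dh].
Qed.

Lemma Ck_onM k U f h : open U -> Ck_on k U f -> Ck_on k U h ->
  Ck_on k U (fun x => f x * h x : R^o).
Proof.
move=> oU; elim: k f h => [|k IH] f h.
  by move=> cf ch x Ux; apply: (@continuousM _ _ f h); [exact: cf|exact: ch].
move=> Cf Ch; case: (Cf) => df Df; case: (Ch) => dh Dh; split=> [x Ux|v].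
  by apply: (@differentiableM _ _ f h); [exact: df|exact: dh].
pose F x : R^o := f x * 'D_v h x + h x * 'D_v f x.
apply: (@eq_Ck_on _ _ _ F) => // [x Ux|].
  by rewrite (@deriveM _ _ f h)//; apply: diff_derivable; [exact: df|exact: dh].
by apply: Ck_onD => //; apply: IH => //; by [exact: Ck_onW|exact: Df|exact: Dh].
Qed.

Lemma Ck_on_sum k U (I : Type) (s : seq I) (F : I -> 'rV[R]_n -> R^o) : open U ->
  (forall i, Ck_on k U (F i)) -> Ck_on k U (fun x => \sum_(i <- s) F i x : R^o).
Proof.
move=> oU CF; elim: s => [|i s IH].
  by under eq_fun do rewrite big_nil; exact: Ck_on_cst.
by under eq_fun do rewrite big_cons; exact: Ck_onD.
Qed.

Lemma Ck_on_entry k U m p (F : 'rV[R]_n -> 'M[R]_(m, p)) i j :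
  open U -> Ck_on k U F -> Ck_on k U (fun x => F x i j : R^o).
Proof.
move=> oU; elim: k F => [|k IH] F /=.
  move=> cF x Ux.
  have cij : {for F x, continuous (fun N : 'M[R]_(m, p) => N i j : R^o)}.
    exact: coord_continuous.
  exact: continuous_comp (cF x Ux) cij.
move=> [dF DF]; split=> [x Ux|v].
  exact: differentiable_comp (dF x Ux) (differentiable_coord _ _ _).
apply: eq_Ck_on (IH _ (DF v)) => // x Ux.
by rewrite derive_mx ?mxE//; exact/diff_derivable/dF.
Qed.

Lemma Ck_on_mx k U m p (F : 'rV[R]_n -> 'M[R]_(m, p)) :
  open U -> (forall i j, Ck_on k U (fun x => F x i j : R^o)) -> Ck_on k U F.
Proof.
move=> oU; elim: k F => [|k IH] F /= CF.
  move=> x Ux; apply/(@cvgrPdist_le _ _ _ (nbhs x) _ F (F x)) => e e0.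
  have : \forall y \near x, forall i : 'I_m * 'I_p,
      `|F x i.1 i.2 - F y i.1 i.2| <= e.
    apply: (@filter_forall _ _ (fun (i : 'I_m * 'I_p) y =>
      `|F x i.1 i.2 - F y i.1 i.2| <= e) (nbhs x)) => i.
    by move: (CF i.1 i.2 x Ux) => /cvgrPdist_le; exact.
  apply: (@filterS _ (nbhs x)) => y Fy.
  rewrite /Num.Def.normr/= mx_normrE (bigmax_le _ (ltW e0))//= => i _.
  by rewrite !mxE; exact: Fy.
have dF x : U x -> differentiable F x.
  move=> Ux.
  (* [F] is the finite sum of its entries times constant matrices, recast below as a sum of
     functions to suit [differentiable_sum]. *)
  have -> : F = fun y => \sum_(i < m) \sum_(j < p) F y i j *: delta_mx i j.
    by apply/funext => y; rewrite -matrix_sum_delta.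
  rewrite (_ : (fun _ => _) =
    \sum_(i < m) (fun y => \sum_(j < p) F y i j *: delta_mx i j)); last first.
    by apply/funext => y; rewrite fct_sumE.
  apply: differentiable_sum => i.
  rewrite (_ : (fun _ => _) =
    \sum_(j < p) (fun y => F y i j *: delta_mx i j)); last first.
    by apply/funext => y; rewrite fct_sumE.
  apply: differentiable_sum => j.
  by apply: differentiableZl; have [+ _] := CF i j; exact.
split=> // v; apply: IH => i j; have [_ /(_ v)] := CF i j.
apply: eq_Ck_on => // x Ux.
by rewrite derive_mx ?mxE//; exact/diff_derivable/dF.
Qed.

Lemma Ck_on_coord k U (i : 'I_n) : Ck_on k U (fun x => x 0 i : R^o).
Proof.
case: k => [x _|k]; first exact: coord_continuous.
split=> [x _|v]; first exact: differentiable_coord.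
rewrite (_ : 'D_v _ = cst (v 0 i : R^o)); first exact: Ck_on_cst.
apply/funext => x; transitivity (('D_v id x) 0 i); last by rewrite derive_id.
by rewrite derive_mx ?mxE//; exact: derivable_id.
Qed.

End CkOn.

Lemma Ck_on_comp (R : realType) (m n k : nat) (U : set 'rV[R]_n)
    (V : set 'rV[R]_m) (f : 'rV[R]_n -> 'rV[R]_m) (h : 'rV[R]_m -> R^o) :
  open U -> (forall x, U x -> V (f x)) -> Ck_on k U f -> Ck_on k V h ->
  Ck_on k U (h \o f).
Proof.
move=> oU UV; elim: k f UV h => [|k IH] f UV h.
  move=> cf ch x Ux; apply: continuous_comp; first exact: cf.
  exact/ch/UV.
move=> Cf Ch; case: (Cf) => df Df; case: (Ch) => dh Dh; split=> [x Ux|v].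
  exact: differentiable_comp (df x Ux) (dh _ (UV x Ux)).
(* The chain rule differentiates [h] in a direction depending on [x]; expanding that direction in
   the basis leaves fixed directions, to which the induction applies. *)
pose F x : R^o := \sum_(i < m) ('D_v f x) 0 i * ('D_(delta_mx 0 i) h \o f) x.
apply: (@eq_Ck_on _ _ _ _ _ F) => // [x Ux|].
  have dfx := df x Ux; have dhx := dh _ (UV x Ux).
  rewrite deriveE; last exact: differentiable_comp.
  rewrite diff_comp//= -(deriveE v dfx) [X in 'd _ _ X]row_sum_delta linear_sum.
  by apply: eq_bigr => i _; rewrite linearZ/= (deriveE _ dhx).
apply: Ck_on_sum => // i; apply: Ck_onM => //.
  exact: (Ck_on_entry 0 i oU (Df v)).
exact: IH UV _ (Ck_onW Cf) (Dh _).
Qed.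

(** * A smooth bump function *)

Section Bump.
Context {R : realType}.

(* The factors t^-k make the family closed under differentiation:
   flat k ' = flat (k+2) - k flat (k+1). *)
Definition flat (k : nat) (t : R) : R :=
  if 0 < t then t^-1 ^+ k * expR (- t^-1) else 0.

Lemma flat_gt0 k t : 0 < t -> 0 < flat k t.
Proof. by move=> t0; rewrite /flat t0 mulr_gt0 ?exprn_gt0 ?invr_gt0 ?expR_gt0. Qed.

Lemma flat_le0 k t : t <= 0 -> flat k t = 0.
Proof. by rewrite /flat ltNge => ->. Qed.

Lemma flatS k t : flat k.+1 t = t^-1 * flat k t.
Proof. by rewrite /flat; case: ifP => _; rewrite ?mulr0// exprS mulrA. Qed.

(* Applied to k+1, this bounds the difference quotient of [flat k] at 0. *)
Lemma norm_flat_le k t : `|flat k t| <= (k.+1)`!%:R * `|t|.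
Proof.
have [t0|t0] := ltP 0 t; last by rewrite flat_le0// normr0 mulr_ge0.
rewrite ger0_norm ?(ltW (flat_gt0 _ _))// gtr0_norm// /flat t0.
have u0 : 0 < t^-1 by rewrite invr_gt0.
(* With u = t^-1 the claim reads u^(k+1) <= (k+1)! e^u, which is a single term of the exponential
   series. *)
have := expR_ge1Dxn k (ltW u0); set u := t^-1 in u0 *; rewrite -[t]invrK -/u => ue.
rewrite expRN ler_pdivrMr ?expR_gt0// mulrAC ler_pdivlMr// -exprSr.
rewrite -ler_pdivrMl ?ltr0n ?fact_gt0// mulrC.
by apply: le_trans ue; rewrite lerDr.
Qed.

(** For t < 0 the function is locally 0, for t > 0 it is the explicit formula, and at t = 0 its
    difference quotient is [flat k.+1 h], which tends to 0 with h. *)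
Lemma is_derive_flat k (t : R) :
  is_derive t 1 (flat k) (flat k.+2 t - k%:R * flat k.+1 t).
Proof.
have [t0|t0|->] := ltgtP t 0.
- rewrite !flat_le0 ?ltW// mulr0 subr0.
  apply: (@near_eq_is_derive _ _ _ (cst 0)).
  by near=> s; rewrite flat_le0// ltW//; near: s; exact: lt_nbhsl.
- apply: (@near_eq_is_derive R R^o R^o (fun s : R => s^-1 ^+ k * expR (- s^-1))).
    near=> s; rewrite /flat ifT//; near: s; exact: lt_nbhsr.
  have tn0 : t != 0 by rewrite gt_eqF.
  have iV : is_derive t 1 (fun s : R => s^-1) (- t ^- 2).
    apply: is_derive_eq; first exact: (@is_deriveV _ id t 1 1 tn0).
    by rewrite [_ *: _]mulr1.
  have iE := @is_derive1_comp _ expR (fun s => - s^-1) t _ _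
    (is_derive_expR _) (is_deriveN iV).
  have iX := @is_deriveX _ _ _ k _ _ _ iV; rewrite exprfctE in iX.
  have iM := @is_deriveM _ _ _ _ _ _ _ _ iX iE.
  refine (@is_derive_eq _ _ _ _ _ _ _ _ iM _).
  rewrite /flat t0 /= -exprVn /GRing.scale /=.
  have ringE (u e : R) : u ^+ k * (e * - - u ^+ 2) + e * (k%:R * u ^+ k.-1 * - u ^+ 2) =
      u ^+ k.+2 * e - k%:R * (u ^+ k.+1 * e).
    (* The case k = 0 is apart because of the exponent [k.-1]; there the factor [k%:R] removes the
       term. *)
    by case: k {iX iM} => [|k]; rewrite /= ?exprS; ring.
  exact: ringE.
- rewrite !flat_le0// mulr0 subr0.
  have lim0 : (fun h => h^-1 *: ((flat k \o shift 0) (h *: 1) - flat k 0)) @ 0^'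
      --> (0 : R).
    apply/cvgrPdist_le => e e0; near=> h.
    rewrite /= sub0r normrN (flat_le0 k (lexx 0)) subr0 addr0 [h%:A]mulr1.
    rewrite -[h^-1 *: _]/(h^-1 * _) -flatS (le_trans (norm_flat_le _ _))//.
    rewrite -ler_pdivlMl ?ltr0n ?fact_gt0//.
    by near: h; apply: dnbhs0_le; rewrite mulr_gt0 ?invr_gt0 ?ltr0n ?fact_gt0.
  by apply: DeriveDef; [apply/cvg_ex; exists 0|apply/cvg_lim].
Unshelve. all: by end_near. Qed.

(** Induction on k with j free: a derivative lowers k, while it raises j to j+1 and j+2. *)
Lemma Ck_on_flat (n k j : nat) (U : set 'rV[R]_n) (q : 'rV[R]_n -> R^o) :
  open U -> (forall i, Ck_on i U q) -> Ck_on k U (flat j \o q : _ -> R^o).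
Proof.
move=> oU Cq.
have df i t : differentiable (flat i : R -> R) t.
  by apply/derivable1_diffP; have [] := is_derive_flat i t.
elim: k j => [|k IH] j.
  move=> x Ux; apply: continuous_comp; first exact: (Cq 0%N x Ux).
  exact: differentiable_continuous.
have [dq _] := Cq 1%N; split=> [x Ux|v].
  exact: differentiable_comp (dq x Ux) (df _ _).
pose F x : R^o := ((flat j.+2 \o q) x + (- j%:R) * (flat j.+1 \o q) x) * 'D_v q x.
apply: (@eq_Ck_on _ _ _ _ _ F) => // [x Ux|].
  rewrite deriveE; last exact: differentiable_comp (dq x Ux) (df _ _).
  rewrite (diff_comp (dq x Ux) (df _ _))/= -(deriveE v (dq x Ux)).
  rewrite -[X in 'd _ _ X]mulr1 [RHS]linearZ -deriveE//.
  have [_ ->] := is_derive_flat j (q x).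
  by rewrite /F /= mulNr mulrC.
apply: Ck_onM => //; last by have [_ Dq] := Cq k.+1; exact: Dq.
by apply: Ck_onD => //; apply: Ck_onM => //; exact: Ck_on_cst.
Qed.

(* A Euclidean ball lies in the ball of the same radius for the sup norm of 'rV[R]_n. *)
Definition smooth_bump (n : nat) (a : 'rV[R]_n) (r : R) (x : 'rV[R]_n) : R :=
  flat 0 (r ^+ 2 - \sum_(i < n) (x 0 i - a 0 i) ^+ 2).

Lemma Ck_on_smooth_bump n (a : 'rV[R]_n) r k U : open U ->
  Ck_on k U (smooth_bump a r : _ -> R^o).
Proof.
move=> oU; apply: Ck_on_flat => // j; apply: Ck_onD => //.
  exact: Ck_on_cst.
have Cs : Ck_on j U (fun x => \sum_(i < n) (x 0 i - a 0 i) ^+ 2 : R^o).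
  have Ca (i : 'I_n) : Ck_on j U (fun x => x 0 i - a 0 i : R^o).
    by apply: Ck_onD => //; [exact: Ck_on_coord|exact: Ck_on_cst].
  by apply: Ck_on_sum => // i; exact: Ck_onM.
apply: eq_Ck_on (Ck_onM oU (Ck_on_cst _ _ (-1 : R^o)) Cs) => // x _.
by rewrite mulN1r.
Qed.

Lemma smooth_bump_center_gt0 n (a : 'rV[R]_n) r : 0 < r -> 0 < smooth_bump a r a.
Proof.
move=> r0; apply: flat_gt0; rewrite big1 ?subr0 ?exprn_gt0// => i _.
by rewrite subrr expr0n.
Qed.

(** Outside the sup-norm ball a single coordinate already contributes more than r^2 to the sum of
    squares, so the argument of [flat] is nonpositive. *)
Lemma smooth_bump_eq0 n (a : 'rV[R]_n) r x : 0 < r -> ~ closed_ball a r x ->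
  smooth_bump a r x = 0.
Proof.
move=> r0; rewrite closed_ballE// /closed_ball_ /= => /negP.
rewrite -ltNge => rx; apply: flat_le0; rewrite subr_le0.
have [i ri] : exists i, r < `|x 0 i - a 0 i|.
  apply: contrapT => /forallNP nri; move: rx; apply/negP; rewrite -leNgt.
  rewrite /Num.Def.normr/= mx_normrE (bigmax_le _ (ltW r0))//= => -[i j] _.
  by rewrite !mxE distrC/= ord1 leNgt; exact/negP/nri.
rewrite (bigD1 i)//= -[leLHS]addr0 lerD ?sumr_ge0// => [|j _]; last exact: sqr_ge0.
by rewrite -[leRHS]real_normK ?num_real// lerXn2r ?nnegrE ?(ltW r0) ?(ltW ri).
Qed.

End Bump.

(** * Transition maps and their Jacobians *)

Section Charts.
Context {R : realType} {n : nat} {M : smooth_manifold R n}.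
Implicit Types (c d e : chart R n M) (p q : M).

Lemma chart_paramK c x : (chart_coord c @` chart_dom c) x ->
  chart_coord c (chart_param c x) = x.
Proof. by move=> [p cp <-]; rewrite chart_coordK. Qed.

Lemma chart_param_dom c x : (chart_coord c @` chart_dom c) x ->
  chart_dom c (chart_param c x).
Proof. by move=> [p cp <-]; rewrite chart_coordK. Qed.

Lemma open_chart_image d (O : set M) : open O ->
  open (chart_coord d @` (O `&` chart_dom d)).
Proof.
move=> oO; rewrite openE => _ [p [Op dp] <-].
have Udp : (chart_coord d @` chart_dom d) (chart_coord d p) by exists p.
have nU := open_nbhs_nbhs (conj (@chart_image_open _ _ _ d) Udp).
have nO : nbhs (chart_coord d p) (chart_param d @^-1` O).
  apply: (chart_param_continuous Udp).
  by apply: open_nbhs_nbhs; split => //; rewrite chart_coordK.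
apply: filterS2 nU nO => x Ux Ox.
exists (chart_param d x); last exact: chart_paramK.
by split=> //; exact: chart_param_dom.
Qed.

Lemma open_chart_overlap c d :
  open (chart_coord c @` (chart_dom c `&` chart_dom d)).
Proof. by rewrite setIC; apply: open_chart_image; exact: chart_dom_open. Qed.

Lemma transitionE c d p : chart_dom c p ->
  transition c d (chart_coord c p) = chart_coord d p.
Proof. by move=> cp; rewrite /transition /= chart_coordK. Qed.

Lemma differentiable_transition c d p : atlas c -> atlas d ->
  chart_dom c p -> chart_dom d p ->
  differentiable (transition c d) (chart_coord c p).
Proof.
move=> ac ad cp dp; have [+ _] := atlas_compatible ac ad 1.
by apply; exists p.
Qed.

Lemma mul_jac c d p v : atlas c -> atlas d -> chart_dom c p -> chart_dom d p ->
  v *m jac c d p = 'D_v (transition c d) (chart_coord c p).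
Proof.
by move=> ac ad cp dp; rewrite deriveEjacobian//; exact: differentiable_transition.
Qed.

Lemma jac_comp c d e p : atlas c -> atlas d -> atlas e ->
  chart_dom c p -> chart_dom d p -> chart_dom e p ->
  jac c e p = jac c d p *m jac d e p.
Proof.
move=> ac ad ae cp dp ep.
have dcd := differentiable_transition ac ad cp dp.
have dde := differentiable_transition ad ae dp ep.
have dde' : differentiable (transition d e) (transition c d (chart_coord c p)).
  by rewrite transitionE.
apply/row_matrixP => i; rewrite !rowE; set v := delta_mx 0 i.
transitivity (('D_v (transition c d) (chart_coord c p)) *m jac d e p); last first.
  rewrite -(mul_jac v ac ad cp dp). by rewrite mulmxA.
rewrite (mul_jac _ ac ae cp ep).
rewrite (mul_jac _ ad ae dp ep).
(* The direct transition map and the composite one are known to agree on the overlap of [c] and [d],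
   an open set around the point, so their derivatives there coincide. *)
have -> : 'D_v (transition c e) (chart_coord c p) =
    'D_v (transition d e \o transition c d) (chart_coord c p).
  apply: near_eq_derive.
  have Wp : (chart_coord c @` (chart_dom c `&` chart_dom d)) (chart_coord c p).
    by exists p.
  have := open_nbhs_nbhs (conj (@open_chart_overlap c d) Wp).
  by apply: filterS => _ [q [cq dq] <-]; rewrite /= !transitionE.
rewrite deriveE; last exact: differentiable_comp dcd dde'.
rewrite (diff_comp dcd dde') /= (deriveE _ dde) (deriveE _ dcd).
by rewrite transitionE.
Qed.

Lemma jac_id c p : atlas c -> chart_dom c p -> jac c c p = 1%:M.
Proof.
move=> ac cp; apply/row_matrixP => i; rewrite !rowE mulmx1 mul_jac//.
rewrite -[RHS](@derive_id _ _ (chart_coord c p)); apply: near_eq_derive.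
have Up : (chart_coord c @` chart_dom c) (chart_coord c p) by exists p.
have := open_nbhs_nbhs (conj (@chart_image_open _ _ _ c) Up).
by apply: filterS => _ [q cq <-]; rewrite transitionE.
Qed.

End Charts.

(** * Extension of tangent vectors to global vector fields *)

Lemma compact_closed_ball (R : realType) (n : nat) (a : 'rV[R]_n) (r : R) :
  0 < r -> compact (closed_ball a r).
Proof.
move=> r0; apply: bounded_closed_compact; last exact: closed_ball_closed.
exists (`|a| + r); split; first exact: num_real.
move=> y ary x; rewrite closed_ballE// /closed_ball_ /= distrC => axr.
rewrite (le_trans _ (ltW ary))// -[x](subrK a) addrC (le_trans (ler_normD _ _))//.
by rewrite lerD2l.
Qed.

Section Extension.
Context {R : realType} {n : nat} {M : smooth_manifold R n}.
Variables (c : chart R n M) (a u : 'rV[R]_n) (r : R).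
Hypotheses (ac : atlas c) (r0 : 0 < r)
  (ball_sub : closed_ball a r `<=` chart_coord c @` chart_dom c).

(** The field with constant components [u] in [c], cut off by the bump, read in the chart [d], and
    extended by 0 off [chart_dom c]. *)
Definition bump_field (d : chart R n M) (q : M) : 'rV[R]_n :=
  if `[< chart_dom c q >]
  then smooth_bump a r (chart_coord c q) *: (u *m jac c d q) else 0.

Let K := chart_param c @` closed_ball a r.

(** A compact subset of a Hausdorff space is closed. Thus the complement of [K], on which the field
    vanishes, is open, and the extension by 0 creates no singularity at the boundary of the chart
    domain. *)
Let closed_K : closed K.
Proof.
apply: compact_closed; first exact: manifold_hausdorff.
apply: continuous_compact; last exact: compact_closed_ball.
apply: continuous_in_subspaceT => x /set_mem xa.
exact/chart_param_continuous/ball_sub.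
Qed.

Lemma bump_field_smooth d : atlas d ->
  smooth_on (chart_coord d @` chart_dom d) (bump_field d \o chart_param d).
Proof.
move=> ad k; set W := chart_coord d @` (chart_dom d `&` chart_dom c).
set V := chart_coord d @` (~` K `&` chart_dom d).
have oW : open W := @open_chart_overlap _ _ _ d c.
have oV : open V by apply: open_chart_image; exact: closed_openC.
(* [W] and [V] cover the chart image, as a point outside [chart_dom c] is outside [K]. On [W] the
   field has its explicit formula, on [V] it is 0. *)
apply: (@Ck_on_subset _ _ _ _ (W `|` V)).
  move=> _ [q dq <-]; have [cq|cq] := pselect (chart_dom c q).
    by left; exists q.
  right; exists q => //; split=> // -[x /ball_sub xc qx]; apply: cq.
  by rewrite -qx; exact: chart_param_dom.
apply: Ck_on_setU.
- set Z := chart_coord c @` (chart_dom c `&` chart_dom d).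
  have oZ : open Z := @open_chart_overlap _ _ _ c d.
  have tW x : W x -> Z (transition d c x).
    by move=> [q [dq cq] <-]; exists q => //; rewrite transitionE.
  apply: Ck_on_mx => // i j.
  (* The product of [u] with the Jacobian is a directional derivative of the transition map, so each
     component is a smooth function of the [c]-coordinates; this costs one order of
     differentiability of the transition map. *)
  pose h (z : 'rV[R]_n) : R^o := smooth_bump a r z * ('D_u (transition c d) z) i j.
  apply: (@eq_Ck_on _ _ _ _ _ (h \o transition d c)) => //.
    move=> _ [q [dq cq] <-]; rewrite /h /= transitionE// chart_coordK//.
    rewrite /bump_field asboolT// mxE; congr (_ * _).
    by rewrite mul_jac.
  apply: (Ck_on_comp oW tW); first exact: (atlas_compatible ad ac k).
  apply: Ck_onM => //; first exact: Ck_on_smooth_bump.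
  apply: Ck_on_entry => //; have [_] := atlas_compatible ac ad k.+1.
  exact.
- apply: (@eq_Ck_on _ _ _ _ _ (cst 0)) => //; last exact: Ck_on_cst.
  move=> _ [q [Kq dq] <-]; rewrite /= chart_coordK// /bump_field.
  case: asboolP => // cq; rewrite smooth_bump_eq0 ?scale0r// => aq; apply: Kq.
  by exists (chart_coord c q) => //; exact: chart_coordK.
Qed.

Lemma bump_field_change d e : atlas d -> atlas e -> forall p,
  chart_dom d p -> chart_dom e p -> bump_field e p = bump_field d p *m jac d e p.
Proof.
move=> ad ae p dp ep; rewrite /bump_field; case: asboolP => [cp|_].
  by rewrite (jac_comp ac ad ae cp dp ep) mulmxA -scalemxAl.
by rewrite mul0mx.
Qed.

End Extension.

Lemma vector_field_through (R : realType) (n : nat) (M : smooth_manifold R n)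
    (c : chart R n M) (p : M) (u : 'rV[R]_n) :
  atlas c -> chart_dom c p -> exists X : vector_field M, X c p = u.
Proof.
move=> ac cp; set a := chart_coord c p.
have Ua : (chart_coord c @` chart_dom c) a by exists p.
have /nbhs_closedballP[r ra] := open_nbhs_nbhs (conj (@chart_image_open _ _ _ c) Ua).
have r0 : 0 < r%:num by [].
(* Dividing by the positive value of the bump at its centre makes the field equal to [u] at [p]. *)
exists (VectorField (bump_field_smooth ((smooth_bump a r%:num a)^-1 *: u) ac r0 ra)
  (bump_field_change a ((smooth_bump a r%:num a)^-1 *: u) r%:num ac)) => /=.
rewrite /bump_field asboolT// jac_id// mulmx1 scalerA mulfV ?scale1r//.
by rewrite gt_eqF// smooth_bump_center_gt0.
Qed.

(** * Symmetry of second derivatives *)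

Section Schwarz.
Context {R : realType} {n : nat}.
Implicit Types (x v w : 'rV[R]_n) (f : 'rV[R]_n -> R^o).

Lemma is_derive_line f x v (t : R) : derivable f (t *: v + x) v ->
  is_derive t 1 (fun s : R => f (s *: v + x) : R^o) ('D_v f (t *: v + x)).
Proof.
pose l (s : R) : R^o := f (s *: v + x).
move=> df; have E : (fun h : R => h^-1 *: ((l \o shift t) (h *: 1) - l t)) =
    (fun h => h^-1 *: ((f \o shift (t *: v + x)) (h *: v) - f (t *: v + x))).
  by apply/funext => h; rewrite /l /= addrA -scalerDl [h%:A]mulr1.
by apply: DeriveDef; rewrite /derivable /derive -/l -/(l t) E.
Qed.

Lemma directional_MVT f x v (s : R) : 0 < s ->
  (forall t, 0 <= t <= s -> differentiable f (t *: v + x)) ->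
  exists2 t, 0 <= t <= s & f (s *: v + x) - f x = 'D_v f (t *: v + x) * s.
Proof.
move=> s0 df; pose h (t : R) : R^o := f (t *: v + x).
have dh t : 0 <= t <= s -> is_derive t (1 : R) h ('D_v f (t *: v + x)).
  by move=> ts; apply: is_derive_line; apply: diff_derivable; exact: df.
have [t||t] := @MVT R h (fun t => 'D_v f (t *: v + x)) 0 s s0.
- by rewrite in_itv/= => /andP[t0 ts]; apply: dh; rewrite !ltW.
- apply: continuous_in_subspaceT => t; rewrite inE/= in_itv/= => ts.
  apply: differentiable_continuous; apply/derivable1_diffP.
  by have [] := dh t ts.
rewrite in_itv/= => /andP[t0 ts]; rewrite /h scale0r add0r subr0 => ->.
by exists t; rewrite ?ltW.
Qed.

Lemma derive_translate f x v w :
  'D_v (fun y => f (w + y) : R^o) x = 'D_v f (w + x).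
Proof.
pose l y : R^o := f (w + y).
have E : (fun h : R => h^-1 *: ((l \o shift x) (h *: v) - l x)) =
    (fun h => h^-1 *: ((f \o shift (w + x)) (h *: v) - f (w + x))).
  by apply/funext => h; rewrite /l /= addrCA.
by rewrite /derive -/l -/(l x) E.
Qed.

(* The left-hand side is symmetric in v and w, so this mixed difference compares the two
   mixed derivatives at nearby points. *)
Lemma second_difference f U x v w (s : R) : 0 < s -> Ck_on 2 U f ->
  (forall t t', 0 <= t <= s -> 0 <= t' <= s -> U (t' *: w + (t *: v + x))) ->
  exists t t', [/\ 0 <= t <= s, 0 <= t' <= s &
    f (s *: w + (s *: v + x)) - f (s *: v + x) - (f (s *: w + x) - f x) =
    'D_w ('D_v f) (t' *: w + (t *: v + x)) * s * s].
Proof.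
move=> s0 [df Df] Us; have s_in : 0 <= s <= s by rewrite ltW/=.
have z_in : 0 <= (0 : R) <= s by rewrite lexx ltW.
(* [h] is the increment of [f] along w. The mean value theorem is applied to [h] along v, then to
   ['D_v f] along w. *)
pose h y : R^o := f (s *: w + y) - f y.
have dfw y : U (s *: w + y) -> differentiable (fun y => f (s *: w + y) : R^o) y.
  move=> Uy; have dsh : differentiable (fun z : 'rV[R]_n => s *: w + z) y.
    by apply: (@differentiableD _ _ _ (cst (s *: w)) id).
  exact: differentiable_comp dsh (df _ Uy).
have Uv t : 0 <= t <= s -> U (t *: v + x).
  by move=> ts; have := Us t 0 ts z_in; rewrite scale0r add0r.
have [t ts ht] : exists2 t, 0 <= t <= s & h (s *: v + x) - h x = 'D_v h (t *: v + x) * s.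
  apply: directional_MVT => // t ts; apply: differentiableB.
    exact/dfw/Us.
  exact/df/Uv.
have [t' ts' ht'] : exists2 t', 0 <= t' <= s &
    'D_v f (s *: w + (t *: v + x)) - 'D_v f (t *: v + x) =
    'D_w ('D_v f) (t' *: w + (t *: v + x)) * s.
  have [dDf _] := Df v.
  by apply: (@directional_MVT ('D_v f) (t *: v + x) w s s0) => t' ts'; exact/dDf/Us.
exists t, t'; split=> //.
move: ht; rewrite /h deriveB; first last.
- by apply: diff_derivable; exact/df/Uv.
- by apply: diff_derivable; exact/dfw/Us.
by rewrite derive_translate ht'.
Qed.

(** By continuity [A x] and [B x] are each within e/2 of a common value taken at nearby, possibly
    different, points. *)
Lemma eq_limit_values (A B : 'rV[R]_n -> R^o) x :
  {for x, continuous A} -> {for x, continuous B} ->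
  (forall d, 0 < d -> exists y z, [/\ `|x - y| < d, `|x - z| < d & A y = B z]) ->
  A x = B x.
Proof.
move=> cA cB AB; apply/eqP; rewrite -subr_eq0 -normr_le0; apply/ler_addgt0Pl => e e0.
rewrite addr0; have e20 : 0 < e / 2 by rewrite divr_gt0.
have : \forall y \near x, `|A x - A y| <= e / 2 /\ `|B x - B y| <= e / 2.
  have /cvgrPdist_le/(_ _ e20) nA := cA; have /cvgrPdist_le/(_ _ e20) nB := cB.
  exact: filterI nA nB.
move=> /nbhs_normP[d /= d0 dP]; have [y [z [/dP[Ay _] /dP[_ Bz] yz]]] := AB d d0.
rewrite (splitr e) -(subrKA (A y)) (le_trans (ler_normD _ _))// lerD//.
by rewrite yz distrC.
Qed.

Lemma derive_comm f U x v w : open U -> Ck_on 2 U f -> U x ->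
  'D_v ('D_w f) x = 'D_w ('D_v f) x.
Proof.
move=> oU Cf Ux.
have cD a b : {for x, continuous ('D_b ('D_a f))}.
  by have [_ /(_ a)[_ /(_ b)]] := Cf; exact.
apply: (@eq_limit_values _ _ x (cD w v) (cD v w)) => {cD} d d0.
have /nbhs_normP[r /= r0 rU] := open_nbhs_nbhs (conj oU Ux).
pose m := Num.min d r; have m0 : 0 < m by rewrite lt_min d0.
(* With this s the parallelogram with sides [s *: v] and [s *: w] at [x] stays within m of [x]. The
   summand 1 keeps the denominator positive when v = w = 0, and the factor 1/2 makes the bound
   strict. *)
pose s := m / (`|v| + `|w| + 1) / 2.
have den0 : 0 < `|v| + `|w| + 1 by rewrite ltr_wpDl ?addr_ge0.
have s0 : 0 < s by rewrite !divr_gt0.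
have sm : s * (`|v| + `|w| + 1) < m.
  by rewrite /s mulrAC divfK ?gt_eqF// ltr_pdivrMr// ltr_pMr// ltr1n.
(* Only the sum of the two norms enters, so the bound serves both orders of v and w. *)
have near_x t t' v' w' : `|v'| + `|w'| = `|v| + `|w| ->
    0 <= t <= s -> 0 <= t' <= s -> `|x - (t' *: w' + (t *: v' + x))| < m.
  move=> vw /andP[t0 ts] /andP[t'0 ts']; apply: le_lt_trans sm.
  rewrite addrA opprD addrCA subrr addr0 normrN (le_trans (ler_normD _ _))//.
  rewrite !normrZ !ger0_norm// mulrDr -vw mulrDr -addrA [leRHS]addrCA.
  by rewrite lerD ?ler_wpM2r// ler_wpDr ?mulr1 ?(ltW s0)// ler_wpM2r.
have near_d y : `|x - y| < m -> `|x - y| < d.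
  by move=> ym; rewrite (lt_le_trans ym)// ge_min lexx.
have near_U y : `|x - y| < m -> U y.
  by move=> ym; apply: rU; rewrite /= (lt_le_trans ym)// ge_min lexx orbT.
have Uvw t t' : 0 <= t <= s -> 0 <= t' <= s -> U (t' *: w + (t *: v + x)).
  by move=> ts ts'; exact/near_U/near_x.
have Uwv t t' : 0 <= t <= s -> 0 <= t' <= s -> U (t' *: v + (t *: w + x)).
  by move=> ts ts'; apply/near_U/near_x => //; exact: addrC.
have swap : f (s *: w + (s *: v + x)) - f (s *: v + x) - (f (s *: w + x) - f x) =
    f (s *: v + (s *: w + x)) - f (s *: w + x) - (f (s *: v + x) - f x).
  rewrite (addrCA (s *: w)).
  move: (f _) (f _) (f _) (f _) => a1 a2 a3 a4; rewrite !opprB addrACA [RHS]addrACA.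
  by congr (_ + _); rewrite addrC.
have [t1 [t1' [t1s t1s' E1]]] := second_difference s0 Cf Uvw.
have [t2 [t2' [t2s t2s' E2]]] := second_difference s0 Cf Uwv.
exists (t2' *: v + (t2 *: w + x)), (t1' *: w + (t1 *: v + x)); split.
- by apply/near_d/near_x => //; exact: addrC.
- exact/near_d/near_x.
have ss : s * s != 0 by rewrite mulf_neq0 ?gt_eqF.
move: swap; rewrite E1 E2 -[LHS]mulrA -[RHS]mulrA => /(mulIf ss) swap.
exact: esym swap.
Qed.

End Schwarz.

(** * Smoothness of reciprocals, determinants and inverse matrices *)

Section CkOnInverse.
Context {R : realType} {n : nat}.
Implicit Types (U : set 'rV[R]_n) (f : 'rV[R]_n -> R^o).

Lemma Ck_onV k U f : open U -> (forall x, U x -> f x != 0) ->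
  Ck_on k U f -> Ck_on k U (fun x => (f x)^-1 : R^o).
Proof.
move=> oU f0; elim: k => [|k IH] Cf.
  by move=> x Ux; apply: (@continuousV _ _ f); [exact: f0|exact: Cf].
case: (Cf) => df Df; split=> [x Ux|v].
  by apply: differentiableV; [exact: df|exact: f0].
have CV := IH (Ck_onW Cf).
pose F x : R^o := (- 1) * ((f x)^-1 * (f x)^-1 * 'D_v f x).
apply: (@eq_Ck_on _ _ _ _ _ F) => // [x Ux|].
  rewrite deriveV; [|exact: f0|by apply: diff_derivable; exact: df].
  by rewrite /F mulN1r -expr2 exprVn scaleNr.
apply: Ck_onM => //; first exact: Ck_on_cst.
by apply: Ck_onM => //; [exact: Ck_onM|exact: Df].
Qed.

Lemma Ck_on_prod k U (I : Type) (s : seq I) (F : I -> 'rV[R]_n -> R^o) : open U ->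
  (forall i, Ck_on k U (F i)) -> Ck_on k U (fun x => \prod_(i <- s) F i x : R^o).
Proof.
move=> oU CF; elim: s => [|i s IH].
  by under eq_fun do rewrite big_nil; exact: Ck_on_cst.
by under eq_fun do rewrite big_cons; exact: Ck_onM.
Qed.

Lemma Ck_on_det k U m (A : 'rV[R]_n -> 'M[R]_m) : open U ->
  (forall i j, Ck_on k U (fun x => A x i j : R^o)) ->
  Ck_on k U (fun x => \det (A x) : R^o).
Proof.
move=> oU CA; rewrite /determinant; apply: Ck_on_sum => // s.
by apply: Ck_onM => //; [exact: Ck_on_cst|exact: Ck_on_prod].
Qed.

(** Cramer's rule: each entry is a cofactor divided by the nonvanishing determinant. *)
Lemma Ck_on_invmx k U m (A : 'rV[R]_n -> 'M[R]_m) : open U ->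
  (forall x, U x -> A x \in unitmx) ->
  (forall i j, Ck_on k U (fun x => A x i j : R^o)) ->
  forall i j, Ck_on k U (fun x => invmx (A x) i j : R^o).
Proof.
move=> oU uA CA i j.
pose F x : R^o := (\det (A x))^-1 * ((-1) ^+ (j + i) * \det (row' j (col' i (A x)))).
apply: (@eq_Ck_on _ _ _ _ _ F) => // [x Ux|].
  by rewrite /F /invmx uA// !mxE.
apply: Ck_onM => //.
  by apply: Ck_onV => // [x /uA|]; [rewrite unitmxE unitfE|exact: Ck_on_det].
apply: Ck_onM => //; first exact: Ck_on_cst.
apply: Ck_on_det => // a b; under eq_fun do rewrite !mxE.
exact: CA.
Qed.

End CkOnInverse.

(** * Coordinate derivatives of functions in a chart *)

Section ChartDerivatives.
Context {R : realType} {n : nat} {M : smooth_manifold R n}.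
Variable c : chart R n M.
Implicit Types (F H : M -> R) (p : M) (i j : 'I_n).

Let U := chart_coord c @` chart_dom c.

Definition smooth_fun F := smooth_on U ((F : M -> R^o) \o chart_param c).

Let oU : open U := @chart_image_open _ _ _ c.
Let Ucoord p : chart_dom c p -> U (chart_coord c p).
Proof. by exists p. Qed.

Lemma eq_coord_deriv i F H p : chart_dom c p ->
  (forall q, chart_dom c q -> F q = H q) ->
  coord_deriv c i F p = coord_deriv c i H p.
Proof.
move=> cp FH; apply: near_eq_derive.
have := open_nbhs_nbhs (conj oU (Ucoord cp)).
by apply: filterS => x /chart_param_dom /FH.
Qed.

Lemma smooth_fun_diff F p : chart_dom c p -> smooth_fun F ->
  differentiable ((F : M -> R^o) \o chart_param c) (chart_coord c p).
Proof. by move=> cp /(_ 1%N)[+ _]; apply; exact: Ucoord. Qed.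

Lemma smooth_fun_derivable i F p : chart_dom c p -> smooth_fun F ->
  derivable ((F : M -> R^o) \o chart_param c) (chart_coord c p) (basis_vec R i).
Proof. by move=> cp sF; apply: diff_derivable; exact: smooth_fun_diff. Qed.

Lemma coord_derivD i F H p : chart_dom c p -> smooth_fun F -> smooth_fun H ->
  coord_deriv c i (fun q => F q + H q) p = coord_deriv c i F p + coord_deriv c i H p.
Proof.
by move=> cp sF sH; apply: deriveD; exact: smooth_fun_derivable.
Qed.

Lemma coord_derivM i F H p : chart_dom c p -> smooth_fun F -> smooth_fun H ->
  coord_deriv c i (fun q => F q * H q) p =
  coord_deriv c i F p * H p + F p * coord_deriv c i H p.
Proof.
move=> cp sF sH; rewrite addrC [_ p * H p]mulrC.
have := deriveM (@smooth_fun_derivable i _ _ cp sF) (@smooth_fun_derivable i _ _ cp sH).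
by rewrite /= chart_coordK.
Qed.

Lemma coord_deriv_cst i (a : R) p : coord_deriv c i (fun=> a) p = 0.
Proof. exact: (@derive_cst _ _ R^o). Qed.

Lemma smooth_fun_cst (a : R) : smooth_fun (fun=> a).
Proof. by move=> k; exact: Ck_on_cst. Qed.

Lemma smooth_funD F H : smooth_fun F -> smooth_fun H ->
  smooth_fun (fun q => F q + H q).
Proof. by move=> sF sH k; exact: Ck_onD. Qed.

Lemma smooth_funM F H : smooth_fun F -> smooth_fun H ->
  smooth_fun (fun q => F q * H q).
Proof. by move=> sF sH k; exact: Ck_onM. Qed.

Lemma smooth_fun_sum (I : Type) (s : seq I) (F : I -> M -> R) :
  (forall a, smooth_fun (F a)) -> smooth_fun (fun q => \sum_(a <- s) F a q).
Proof. by move=> sF k; apply: Ck_on_sum => // i; exact: sF. Qed.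

Lemma coord_deriv_sum i (I : Type) (s : seq I) (F : I -> M -> R) p :
  chart_dom c p -> (forall a, smooth_fun (F a)) ->
  coord_deriv c i (fun q => \sum_(a <- s) F a q) p =
  \sum_(a <- s) coord_deriv c i (F a) p.
Proof.
move=> cp sF; elim: s => [|a s IH].
  by rewrite big_nil; under eq_fun do rewrite big_nil; exact: coord_deriv_cst.
rewrite big_cons -IH; under eq_fun do rewrite big_cons.
by apply: coord_derivD => //; exact: smooth_fun_sum.
Qed.

Lemma coord_deriv_param i F x : U x ->
  coord_deriv c i F (chart_param c x) =
  'D_(basis_vec R i) ((F : M -> R^o) \o chart_param c) x.
Proof. by move=> Ux; rewrite /coord_deriv chart_paramK. Qed.

Lemma smooth_coord_deriv i F : smooth_fun F -> smooth_fun (coord_deriv c i F).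
Proof.
move=> sF k; have [_ /(_ (basis_vec R i))] := sF k.+1.
by apply: eq_Ck_on => // x Ux; rewrite /= coord_deriv_param.
Qed.

(** On the open chart image the inner [coord_deriv] is a directional derivative of the coordinate
    expression of [F], so [derive_comm] applies. *)
Lemma coord_deriv_comm i j F p : chart_dom c p -> smooth_fun F ->
  coord_deriv c i (coord_deriv c j F) p = coord_deriv c j (coord_deriv c i F) p.
Proof.
move=> cp sF; have nU := open_nbhs_nbhs (conj oU (Ucoord cp)).
transitivity ('D_(basis_vec R i) ('D_(basis_vec R j)
    ((F : M -> R^o) \o chart_param c)) (chart_coord c p)).
  apply: near_eq_derive; apply: filterS nU => x Ux.
  exact: coord_deriv_param.
rewrite (derive_comm _ _ oU (sF 2) (Ucoord cp)).
apply/esym/near_eq_derive; apply: filterS nU => x Ux.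
exact: coord_deriv_param.
Qed.

End ChartDerivatives.

(** * Christoffel symbols and the symmetries of the Riemann tensor in coordinates *)

Section LeviCivita.
Context {R : realType} {n : nat} {M : smooth_manifold R n}.
Variables (g : semi_riemannian_metric M) (c : chart R n M).
Hypothesis ac : atlas c.
Implicit Types (p : M) (i j k l m : 'I_n).

Lemma smooth_metric i j : smooth_fun c (fun q => g c q i j).
Proof.
move=> k; apply: (@Ck_on_entry _ _ _ _ _ _ (g c \o chart_param c)).
  exact: chart_image_open.
exact: metric_smooth.
Qed.

Lemma metric_mx_sym p i j : chart_dom c p -> g c p i j = g c p j i.
Proof. by move=> cp; rewrite -{1}(Defs.metric_sym g ac cp) mxE. Qed.

Lemma metric_inv_sym p i j : chart_dom c p ->
  metric_inv g c p i j = metric_inv g c p j i.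
Proof.
by move=> cp; rewrite -[metric_inv g c p in RHS]trmxK mxE trmx_inv Defs.metric_sym.
Qed.

Lemma smooth_metric_inv i j : smooth_fun c (fun q => metric_inv g c q i j).
Proof.
move=> k; apply: (@Ck_on_invmx _ _ _ _ _ (g c \o chart_param c)).
- exact: chart_image_open.
- by move=> x Ux; apply: metric_nondegenerate => //; exact: chart_param_dom.
- by move=> a b; exact: smooth_metric.
Qed.

Lemma metric_invK p i j : chart_dom c p ->
  \sum_(m < n) metric_inv g c p i m * g c p m j = (i == j)%:R.
Proof.
move=> cp; have := mulVmx (metric_nondegenerate g ac cp).
by move/matrixP/(_ i j); rewrite !mxE.
Qed.

Lemma coord_deriv_metric_sym a i j p : chart_dom c p ->
  coord_deriv c a (fun q => g c q i j) p = coord_deriv c a (fun q => g c q j i) p.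
Proof. by move=> cp; apply: eq_coord_deriv => // q cq; exact: metric_mx_sym. Qed.

(** The Christoffel symbols of the first kind, g(nabla_i d_j, d_l). *)
Definition christoffel_down i j l p : R :=
  2^-1 * (coord_deriv c i (fun q => g c q j l) p +
          coord_deriv c j (fun q => g c q i l) p -
          coord_deriv c l (fun q => g c q i j) p).

Lemma christoffelE i j k p :
  christoffel g c i j k p = \sum_(l < n) metric_inv g c p k l * christoffel_down i j l p.
Proof.
rewrite /christoffel mulr_sumr; apply: eq_bigr => l _.
by rewrite /christoffel_down mulrCA.
Qed.

Lemma christoffel_downC i j l p : chart_dom c p ->
  christoffel_down i j l p = christoffel_down j i l p.
Proof.
move=> cp; rewrite /christoffel_down (coord_deriv_metric_sym l i j cp).
by congr (_ * (_ - _)); rewrite addrC.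
Qed.

Lemma smooth_christoffel_down i j l : smooth_fun c (christoffel_down i j l).
Proof.
apply: smooth_funM; first exact: smooth_fun_cst.
apply: smooth_funD.
  by apply: smooth_funD; apply: smooth_coord_deriv; exact: smooth_metric.
have -> : (fun q => - coord_deriv c l (fun q0 => g c q0 i j) q) =
    (fun q => (-1) * coord_deriv c l (fun q0 => g c q0 i j) q).
  by apply/funext => q; rewrite mulN1r.
apply: smooth_funM; first exact: smooth_fun_cst.
by apply: smooth_coord_deriv; exact: smooth_metric.
Qed.

Lemma smooth_christoffel i j k : smooth_fun c (christoffel g c i j k).
Proof.
rewrite (_ : christoffel g c i j k =
    fun p => \sum_(l < n) metric_inv g c p k l * christoffel_down i j l p).
  apply: smooth_fun_sum => l; apply: smooth_funM; first exact: smooth_metric_inv.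
  exact: smooth_christoffel_down.
by apply/funext => p; exact: christoffelE.
Qed.

Lemma christoffel_lower i j l p : chart_dom c p ->
  \sum_(m < n) christoffel g c i j m p * g c p m l = christoffel_down i j l p.
Proof.
move=> cp; under eq_bigr do rewrite christoffelE mulr_suml.
rewrite exchange_big/= (eq_bigr (fun r => christoffel_down i j r p * (r == l)%:R)).
  rewrite (bigD1 l)//= big1 ?addr0 ?eqxx ?mulr1// => r /negPf ->.
  by rewrite mulr0.
move=> r _; rewrite -(metric_invK r l cp) mulr_sumr; apply: eq_bigr => m _.
by rewrite (metric_inv_sym m r cp) [metric_inv _ _ _ _ _ * _]mulrC mulrA.
Qed.

(** This is nabla g = 0: in the sum of the two symbols the derivatives along m and l cancel. *)
Lemma coord_deriv_metric a m l p : chart_dom c p ->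
  coord_deriv c a (fun q => g c q m l) p =
  christoffel_down a m l p + christoffel_down a l m p.
Proof.
move=> cp; rewrite /christoffel_down (coord_deriv_metric_sym a l m cp).
rewrite (coord_deriv_metric_sym m a l cp) (coord_deriv_metric_sym l a m cp).
have fieldE (x y z : R) : x = 2^-1 * (x + y - z) + 2^-1 * (x + z - y) by field.
exact: fieldE.
Qed.

(** The inner product g(nabla_a d_b, nabla_i d_l). *)
Definition christoffel_quad a b i l p : R :=
  \sum_(m < n) christoffel g c a b m p * christoffel_down i l m p.

(** The reason is g(nabla_i nabla_j d_k, d_l) = d_i g(nabla_j d_k, d_l) - g(nabla_j d_k, nabla_i
    d_l), skew-symmetrized in i and j. *)
Lemma riemann_downE i j k l p : chart_dom c p ->
  riemann_down g c i j k l p =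
  coord_deriv c i (christoffel_down j k l) p - coord_deriv c j (christoffel_down i k l) p
  - christoffel_quad j k i l p + christoffel_quad i k j l p.
Proof.
move=> cp.
(* The product rule for the lowered symbol, where the derivative of the metric is replaced through
   [coord_deriv_metric]. *)
have lower_deriv a b d :
    \sum_(m < n) coord_deriv c a (christoffel g c b d m) p * g c p m l =
    coord_deriv c a (christoffel_down b d l) p -
    (\sum_(m < n) christoffel g c b d m p * christoffel_down a m l p +
     christoffel_quad b d a l p).
  rewrite -big_split /=; apply/eqP; rewrite eq_sym subr_eq -big_split; apply/eqP.
  rewrite -(@eq_coord_deriv _ _ _ _ a _ _ _ cp (fun q => @christoffel_lower b d l q)).
  rewrite coord_deriv_sum// => [|m]; last first.
    by apply: smooth_funM; [exact: smooth_christoffel|exact: smooth_metric].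
  apply: eq_bigr => m _; rewrite coord_derivM//.
  - by rewrite (coord_deriv_metric a m l cp) mulrDr.
  - exact: smooth_christoffel.
  - exact: smooth_metric.
(* These terms cancel the first correction term of [lower_deriv]. *)
have lower_quad a b d e :
    \sum_(m < n) (\sum_(r < n) christoffel g c a r m p * christoffel g c b d r p) *
      g c p m e =
    \sum_(m < n) christoffel g c b d m p * christoffel_down a m e p.
  under eq_bigr do rewrite mulr_suml.
  rewrite exchange_big; apply: eq_bigr => r _ /=.
  rewrite -(christoffel_lower a r e cp) mulr_sumr; apply: eq_bigr => m _.
  by rewrite [_ a r m p * _]mulrC mulrA.
have -> : riemann_down g c i j k l p =
    \sum_(m < n) coord_deriv c i (christoffel g c j k m) p * g c p m l -
    \sum_(m < n) coord_deriv c j (christoffel g c i k m) p * g c p m l +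
    (\sum_(m < n) (\sum_(r < n) christoffel g c i r m p * christoffel g c j k r p) *
       g c p m l -
     \sum_(m < n) (\sum_(r < n) christoffel g c j r m p * christoffel g c i k r p) *
       g c p m l).
  rewrite -[X in X + _]sumrB -[X in _ + X]sumrB -big_split; apply: eq_bigr => m _ /=.
  by rewrite -!mulrBl -mulrDl -sumrB.
have step (a1 a2 b1 b2 d1 d2 e1 e2 : R) : a1 = a2 -> b1 = b2 -> d1 = d2 -> e1 = e2 ->
    a1 - b1 + (d1 - e1) = a2 - b2 + (d2 - e2) by move=> -> -> -> ->.
apply: etrans (step _ _ _ _ _ _ _ _ (lower_deriv i j k) (lower_deriv j i k)
  (lower_quad i j k l) (lower_quad j i k l)) _.
have ringE (a1 b1 q1 a2 b2 q2 : R) :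
    a1 - (b1 + q1) - (a2 - (b2 + q2)) + (b1 - b2) = a1 - a2 - q1 + q2 by ring.
exact: ringE.
Qed.

Lemma christoffel_quadE a b i l p : christoffel_quad a b i l p =
  \sum_(m < n) \sum_(r < n)
    metric_inv g c p m r * christoffel_down a b r p * christoffel_down i l m p.
Proof. by apply: eq_bigr => m _; rewrite christoffelE mulr_suml. Qed.

Lemma christoffel_quad_swap a b i l p : chart_dom c p ->
  christoffel_quad a b i l p = christoffel_quad i l a b p.
Proof.
move=> cp; rewrite !christoffel_quadE exchange_big; apply: eq_bigr => m _.
by apply: eq_bigr => r _; rewrite metric_inv_sym// mulrAC.
Qed.

Lemma christoffel_quadCl a b i l p : chart_dom c p ->
  christoffel_quad a b i l p = christoffel_quad b a i l p.
Proof.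
move=> cp; rewrite !christoffel_quadE; apply: eq_bigr => m _; apply: eq_bigr => r _.
by rewrite (christoffel_downC a b r cp).
Qed.

Lemma coord_deriv_christoffel_down a j k l p : chart_dom c p ->
  coord_deriv c a (christoffel_down j k l) p =
  2^-1 * (coord_deriv c a (coord_deriv c j (fun q => g c q k l)) p +
          coord_deriv c a (coord_deriv c k (fun q => g c q j l)) p -
          coord_deriv c a (coord_deriv c l (fun q => g c q j k)) p).
Proof.
move=> cp; have sm b i m : smooth_fun c (coord_deriv c b (fun q => g c q i m)).
  by apply: smooth_coord_deriv; exact: smooth_metric.
have sc (r : R) := @smooth_fun_cst _ _ _ c r.
rewrite (@eq_coord_deriv _ _ _ _ a _ (fun q => 2^-1 *
  (coord_deriv c j (fun q => g c q k l) q + coord_deriv c k (fun q => g c q j l) q +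
   (-1) * coord_deriv c l (fun q => g c q j k) q)) p cp); last first.
  by move=> q _; rewrite mulN1r.
rewrite coord_derivM//; last by do 2?apply: smooth_funD => //; exact: smooth_funM.
rewrite coord_deriv_cst mul0r add0r coord_derivD//; last 2 first.
- exact: smooth_funD.
- exact: smooth_funM.
by rewrite coord_derivD// coord_derivM// coord_deriv_cst mul0r add0r mulN1r.
Qed.

Lemma coord_deriv2_metric_sym a b i j p : chart_dom c p ->
  coord_deriv c a (coord_deriv c b (fun q => g c q i j)) p =
  coord_deriv c a (coord_deriv c b (fun q => g c q j i)) p.
Proof. by move=> cp; apply: eq_coord_deriv => // q cq; exact: coord_deriv_metric_sym. Qed.

(* Here the symmetries of the curvature can be read off. *)
Lemma riemann_down_second i j k l p : chart_dom c p ->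
  riemann_down g c i j k l p =
  2^-1 * (coord_deriv c i (coord_deriv c k (fun q => g c q j l)) p -
          coord_deriv c i (coord_deriv c l (fun q => g c q j k)) p -
          coord_deriv c j (coord_deriv c k (fun q => g c q i l)) p +
          coord_deriv c j (coord_deriv c l (fun q => g c q i k)) p)
  - christoffel_quad j k i l p + christoffel_quad i k j l p.
Proof.
move=> cp; rewrite riemann_downE// !coord_deriv_christoffel_down//.
(* The terms d_i d_j g_kl and d_j d_i g_kl cancel. *)
rewrite (coord_deriv_comm i j cp (smooth_metric k l)).
have ringE (h a b d e f q r : R) :
    h * (a + b - d) - h * (a + e - f) - q + r = h * (b - d - e + f) - q + r by ring.
exact: ringE.
Qed.

Lemma riemann_down_skew12 i j k l p :
  riemann_down g c j i k l p = - riemann_down g c i j k l p.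
Proof.
rewrite /riemann_down -sumrN; apply: eq_bigr => m _; rewrite -mulNr; congr (_ * _).
rewrite /riemann_up !opprD opprK -sumrN [X in X + _]addrC; congr (_ + _).
by apply: eq_bigr => r _; rewrite opprB.
Qed.

(** Under the exchange of k and l the bracket of second derivatives changes sign, and the two
    quadratic terms trade places by the symmetry of the inner product. *)
Lemma riemann_down_skew34 i j k l p : chart_dom c p ->
  riemann_down g c i j l k p = - riemann_down g c i j k l p.
Proof.
move=> cp; rewrite !riemann_down_second//.
rewrite (christoffel_quad_swap j l i k cp) (christoffel_quad_swap i l j k cp).
have ringE (h a b d e q r : R) :
    h * (a - b - d + e) - q + r = - (h * (b - a - e + d) - r + q) by ring.
exact: ringE.
Qed.

(** Exchanging the pairs permutes the second derivatives, up to the symmetry of g and of mixed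
    derivatives; the quadratic terms agree because the connection is torsion-free. *)
Lemma riemann_down_pair i j k l p : chart_dom c p ->
  riemann_down g c k l i j p = riemann_down g c i j k l p.
Proof.
move=> cp; rewrite !riemann_down_second//.
rewrite (coord_deriv_comm k i cp (smooth_metric l j)).
rewrite (coord_deriv_comm k j cp (smooth_metric l i)).
rewrite (coord_deriv_comm l i cp (smooth_metric k j)).
rewrite (coord_deriv_comm l j cp (smooth_metric k i)).
rewrite (coord_deriv2_metric_sym i k l j cp) (coord_deriv2_metric_sym j k l i cp).
rewrite (coord_deriv2_metric_sym i l k j cp) (coord_deriv2_metric_sym j l k i cp).
rewrite (christoffel_quad_swap l i k j cp) (christoffel_quadCl k j l i cp).
rewrite (christoffel_quad_swap j k l i cp) (christoffel_quadCl l i j k cp).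
rewrite (christoffel_quad_swap i l j k cp).
rewrite (christoffel_quadCl k i l j cp) (christoffel_quad_swap i k l j cp).
rewrite (christoffel_quadCl l j i k cp) (christoffel_quad_swap j l i k cp).
have ringE (h a b d e q r : R) :
    h * (a - b - d + e) - q + r = h * (a - d - b + e) - q + r by ring.
exact: ringE.
Qed.

End LeviCivita.

(** * Linear forms on coordinate vectors *)

Section LinearForms.
Context {R : realType} {n : nat}.
Implicit Types (f : 'rV[R]_n -> R) (u v : 'rV[R]_n).

(** Linearity is encoded as expansion in the basis, the form in which traces use it. *)
Definition linear_form f := forall u, f u = \sum_(i < n) u 0 i * f (basis_vec R i).

Lemma linear_form_coef f (a : 'I_n -> R) :
  (forall u, f u = \sum_(i < n) u 0 i * a i) -> linear_form f.
Proof.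
move=> fa u; rewrite fa; apply: eq_bigr => i _; rewrite fa (bigD1 i)//= big1 ?addr0.
  by rewrite mxE !eqxx mul1r.
by move=> j /negPf ji; rewrite mxE ji andbF mul0r.
Qed.

Lemma linear_formD f u v : linear_form f -> f (u + v) = f u + f v.
Proof.
move=> lf; rewrite (lf (u + v)) (lf u) (lf v) -big_split; apply: eq_bigr => i _ /=.
by rewrite mxE mulrDl.
Qed.

Lemma linear_form_comb f f' (a b : R) : linear_form f -> linear_form f' ->
  linear_form (fun u => a * f u + b * f' u).
Proof.
move=> lf lf' u; rewrite (lf u) (lf' u) !mulr_sumr -big_split; apply: eq_bigr => i _ /=.
by rewrite mulrDr !(mulrCA (u 0 i)).
Qed.

End LinearForms.

(** * Traces and the symmetries of the curvature at a point *)

Section CurvatureAtPoint.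
Context {R : realType} {n : nat} {M : smooth_manifold R n}.
Variables (g : semi_riemannian_metric M) (c : chart R n M) (p : M).
Hypotheses (ac : atlas c) (cp : chart_dom c p) (n_ge3 : (3 <= n)%N).
Implicit Types (X Y Z W : 'rV[R]_n).

Local Notation gm := (metric_at g c p).
Local Notation Rm := (riemann g c p).
Local Notation Ric := (ricci g c p).
Local Notation P := (projective g c p).
Local Notation e := (basis_vec R).
Local Notation N := (n%:R : R).

(** The g-trace over two slots; [ricci] and [scalar_curvature] unfold to instances of it. *)
Definition trace_form (B : 'rV[R]_n -> 'rV[R]_n -> R) : R :=
  \sum_(a < n) \sum_(b < n) metric_inv g c p a b * B (e a) (e b).

Lemma eq_trace_form B B' : (forall X Y, B X Y = B' X Y) -> trace_form B = trace_form B'.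
Proof. by move=> BB; do 2!apply: eq_bigr => ? _; rewrite BB. Qed.

Lemma trace_formC B : trace_form (fun X Y => B Y X) = trace_form B.
Proof.
rewrite /trace_form exchange_big; apply: eq_bigr => a _; apply: eq_bigr => b _.
by rewrite (metric_inv_sym g ac b a cp).
Qed.

Lemma trace_form_comb B B' (a b : R) :
  trace_form (fun X Y => a * B X Y + b * B' X Y) = a * trace_form B + b * trace_form B'.
Proof.
rewrite /trace_form !mulr_sumr -big_split; apply: eq_bigr => i _ /=.
rewrite !mulr_sumr -big_split; apply: eq_bigr => j _ /=.
by rewrite mulrDr !(mulrCA (metric_inv _ _ _ _ _)).
Qed.

Lemma trace_formZ B (a : R) : trace_form (fun X Y => a * B X Y) = a * trace_form B.
Proof.
rewrite -[RHS]addr0 -(mul0r (trace_form B)) -trace_form_comb.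
by apply: eq_trace_form => X Y; rewrite mul0r addr0.
Qed.

Lemma trace_form0 : trace_form (fun _ _ => 0) = 0.
Proof. by rewrite /trace_form big1// => a _; rewrite big1// => b _; rewrite mulr0. Qed.

Lemma exchange_trace_form B :
  trace_form (fun X Y => trace_form (fun Z W => B X Y Z W)) =
  trace_form (fun Z W => trace_form (fun X Y => B X Y Z W)).
Proof.
pose F a b i j := metric_inv g c p a b *
  (metric_inv g c p i j * B (e a) (e b) (e i) (e j)).
transitivity (\sum_a \sum_b \sum_i \sum_j F a b i j).
  apply: eq_bigr => a _; apply: eq_bigr => b _; rewrite mulr_sumr.
  by apply: eq_bigr => i _; rewrite mulr_sumr.
transitivity (\sum_i \sum_j \sum_a \sum_b F a b i j); last first.
  apply: eq_bigr => i _; apply: eq_bigr => j _; rewrite mulr_sumr; apply: eq_bigr => a _.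
  by rewrite mulr_sumr; apply: eq_bigr => b _; rewrite /F mulrCA.
under eq_bigr do rewrite exchange_big; rewrite exchange_big.
apply: eq_bigr => i _ /=.
transitivity (\sum_a \sum_j \sum_b F a b i j); last by rewrite exchange_big.
by apply: eq_bigr => a _; rewrite exchange_big.
Qed.

Lemma metric_at_sum X Y : gm X Y = \sum_(i < n) \sum_(j < n) X 0 i * (Y 0 j * g c p i j).
Proof.
rewrite /metric_at mxE exchange_big; apply: eq_bigr => j _ /=.
rewrite [Y^T _ _]mxE mxE mulr_suml; apply: eq_bigr => i _.
by rewrite -mulrA [g c p i j * _]mulrC.
Qed.

Lemma metric_atC X Y : gm X Y = gm Y X.
Proof.
rewrite !metric_at_sum exchange_big; apply: eq_bigr => i _; apply: eq_bigr => j _.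
by rewrite (metric_mx_sym g ac i j cp) mulrCA.
Qed.

Lemma linear_metric_at Y : linear_form (gm^~ Y).
Proof.
apply: (@linear_form_coef _ _ _ (fun i => \sum_j Y 0 j * g c p i j)) => X.
by rewrite metric_at_sum; apply: eq_bigr => i _; rewrite mulr_sumr.
Qed.

Lemma metric_at_basis i j : gm (e i) (e j) = g c p i j.
Proof.
rewrite metric_at_sum (bigD1 i)//= [X in _ + X]big1 ?addr0.
  rewrite (bigD1 j)//= big1 ?addr0; first by rewrite !mxE !eqxx !mul1r.
  by move=> k /negPf kj; rewrite [e j _ _]mxE kj andbF mul0r mulr0.
move=> k /negPf ki; apply: big1 => l _; rewrite [e i _ _]mxE ki andbF mul0r//.
Qed.

(** The factor g(Y, .) lowers the index of [Y] and the trace raises it again, so [Y] is substituted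
    into [f]. *)
Lemma trace_metric_form f Y : linear_form f ->
  trace_form (fun A B => f A * gm Y B) = f Y.
Proof.
move=> lf; rewrite [RHS]lf; apply: eq_bigr => a _.
under eq_bigr do rewrite mulrCA.
rewrite -mulr_sumr mulrC; congr (_ * _).
rewrite (eq_bigr (fun b => \sum_(i < n) Y 0 i * (metric_inv g c p a b * g c p b i))).
  rewrite exchange_big (bigD1 a)//= -mulr_sumr metric_invK// eqxx mulr1 big1 ?addr0//.
  by move=> i /negPf ia; rewrite -mulr_sumr metric_invK// eq_sym ia mulr0.
move=> b _; rewrite (linear_metric_at _ Y) mulr_sumr; apply: eq_bigr => i _.
by rewrite metric_at_basis (metric_mx_sym g ac i b cp) mulrCA.
Qed.

Lemma trace_metric : trace_form gm = N.
Proof.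
rewrite /trace_form (eq_bigr (fun=> 1)) ?sumr_const ?card_ord// => a _.
have := metric_invK g ac a a cp; rewrite eqxx mulr1n => <-.
by apply: eq_bigr => b _; rewrite metric_at_basis (metric_mx_sym g ac a b cp).
Qed.

Lemma riemann_skew12 X1 X2 X3 X4 : Rm X2 X1 X3 X4 = - Rm X1 X2 X3 X4.
Proof.
rewrite /riemann -sumrN [LHS]exchange_big; apply: eq_bigr => i _; rewrite -sumrN.
apply: eq_bigr => j _; rewrite -sumrN; apply: eq_bigr => k _; rewrite -sumrN.
apply: eq_bigr => l _; rewrite riemann_down_skew12 !mulNr.
by rewrite (mulrAC _ (X2 0 j)).
Qed.

Lemma riemann_skew34 X1 X2 X3 X4 : Rm X1 X2 X4 X3 = - Rm X1 X2 X3 X4.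
Proof.
rewrite /riemann -sumrN; apply: eq_bigr => i _; rewrite -sumrN.
apply: eq_bigr => j _; rewrite -sumrN exchange_big; apply: eq_bigr => k _; rewrite -sumrN.
apply: eq_bigr => l _; rewrite (riemann_down_skew34 g ac i j k l cp) !mulNr.
by rewrite (mulrAC _ (X4 0 l)).
Qed.

Lemma riemann_pair X1 X2 X3 X4 : Rm X3 X4 X1 X2 = Rm X1 X2 X3 X4.
Proof.
(* With each pair of indices taken as one index, the pair symmetry needs a single exchange of
   sums. *)
have pairE Y1 Y2 Y3 Y4 : Rm Y1 Y2 Y3 Y4 = \sum_(u : 'I_n * 'I_n) \sum_(v : 'I_n * 'I_n)
    riemann_down g c u.1 u.2 v.1 v.2 p * Y1 0 u.1 * Y2 0 u.2 * Y3 0 v.1 * Y4 0 v.2.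
  rewrite /riemann pair_bigA; apply: eq_bigr => u _ /=.
  by rewrite pair_bigA.
rewrite !pairE exchange_big; apply: eq_bigr => -[i j] _; apply: eq_bigr => -[k l] _ /=.
rewrite (riemann_down_pair g ac i j k l cp).
have ringE (r x1 x2 x3 x4 : R) : r * x3 * x4 * x1 * x2 = r * x1 * x2 * x3 * x4 by ring.
exact: ringE.
Qed.

Lemma linear_riemann1 X2 X3 X4 : linear_form (fun X => Rm X X2 X3 X4).
Proof.
apply: (@linear_form_coef _ _ _ (fun i => \sum_j \sum_k \sum_l
  riemann_down g c i j k l p * X2 0 j * X3 0 k * X4 0 l)) => X.
apply: eq_bigr => i _; do 3?[rewrite mulr_sumr; apply: eq_bigr => ? _].
by rewrite !mulrA (mulrC (X 0 i)).
Qed.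

Lemma linear_riemann2 X1 X3 X4 : linear_form (fun X => Rm X1 X X3 X4).
Proof.
move=> X; rewrite -[LHS]opprK -riemann_skew12 linear_riemann1 -sumrN.
by apply: eq_bigr => i _; rewrite -mulrN -riemann_skew12.
Qed.

Lemma linear_ricci Z : linear_form (Ric^~ Z).
Proof.
move=> X; rewrite /ricci; under [RHS]eq_bigr do rewrite mulr_sumr.
rewrite [RHS]exchange_big; apply: eq_bigr => a _ /=.
under [RHS]eq_bigr do rewrite mulr_sumr.
rewrite [RHS]exchange_big; apply: eq_bigr => b _ /=.
rewrite linear_riemann2 mulr_sumr; apply: eq_bigr => i _.
by rewrite mulrCA.
Qed.

(** R(B,Y,Z,A) = R(Z,A,B,Y) = R(A,Z,Y,B), by the pair symmetry and the two skew-symmetries; the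
    trace is symmetric in A and B. *)
Lemma ricciC Y Z : Ric Y Z = Ric Z Y.
Proof.
transitivity (trace_form (fun A B => Rm A Y Z B)) => //.
rewrite -trace_formC -[RHS]/(trace_form (fun A B => Rm A Z Y B)).
apply: eq_trace_form => A B.
by rewrite -riemann_pair riemann_skew12 riemann_skew34 opprK.
Qed.

Lemma linear_riccir Y : linear_form (Ric Y).
Proof.
by move=> Z; rewrite ricciC (linear_ricci Y Z); apply: eq_bigr => i _; rewrite ricciC.
Qed.

Lemma trace_riemann23 X Y : trace_form (fun A B => Rm X A B Y) = Ric X Y.
Proof.
rewrite -[RHS]/(trace_form (fun A B => Rm A X Y B)); apply: eq_trace_form => A B.
by rewrite riemann_skew12 riemann_skew34 opprK.
Qed.

(** * Contractions of the projective tensor and the vanishing of the traceless Ricci tensor *)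

Let N0 : N != 0. Proof. by rewrite pnatr_eq0; case: (n) n_ge3. Qed.

Let N1 : N - 1 != 0.
Proof. by rewrite subr_eq0 pnatr_eq1; case: (n) n_ge3 => [|[]]. Qed.

(** The correction terms have traces n S(Y,Z) and S(Y,Z), so their difference divided by n - 1 is
    exactly the trace S(Y,Z) of R. *)
Lemma trace_projective14 Y Z : trace_form (fun A B => P A Y Z B) = 0.
Proof.
have tr := trace_metric_form Y (linear_ricci Z).
rewrite (_ : trace_form _ = 1 * trace_form (fun A B => Rm A Y Z B) +
  (- (N - 1)^-1) * trace_form (fun A B => Ric Y Z * gm A B + (-1) * (Ric A Z * gm Y B))).
  rewrite trace_form_comb tr trace_metric.
  rewrite [trace_form _](_ : _ = Ric Y Z)//; move: (Ric Y Z) => r.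
  by field.
rewrite -trace_form_comb; apply: eq_trace_form => A B.
by rewrite /projective mul1r mulN1r mulNr.
Qed.

Local Notation kap := (scalar_curvature g c p).

Definition traceless_ricci X Y : R := Ric X Y - kap / N * gm X Y.
Local Notation E := traceless_ricci.

Lemma traceless_ricciC X Y : E X Y = E Y X.
Proof. by rewrite /traceless_ricci ricciC metric_atC. Qed.

Lemma linear_traceless_ricci Y : linear_form (E^~ Y).
Proof.
have := linear_form_comb 1 (- (kap / N)) (linear_ricci Y) (linear_metric_at Y).
by congr linear_form; apply/funext => X; rewrite mul1r mulNr.
Qed.

(** The trace is S - (kappa g - S)/(n-1) at (X,Y), which is n/(n-1) times S - (kappa/n) g. *)
Lemma trace_projective23 X Y :
  trace_form (fun A B => P X A B Y) = N / (N - 1) * E X Y.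
Proof.
have tr : trace_form (fun A B => Ric X B * gm A Y) = Ric X Y.
  rewrite -[RHS](trace_metric_form Y (linear_riccir X)) -trace_formC.
  by apply: eq_trace_form => A B; rewrite metric_atC.
rewrite (_ : trace_form _ = 1 * trace_form (fun A B => Rm X A B Y) +
  (- (N - 1)^-1) * trace_form (fun A B => gm X Y * Ric A B + (-1) * (Ric X B * gm A Y))).
  rewrite trace_form_comb tr trace_riemann23 /traceless_ricci.
  rewrite [trace_form _](_ : _ = kap)//.
  move: (Ric X Y) (gm X Y) (kap) => r m k; field.
  by rewrite N0 N1.
rewrite -trace_form_comb; apply: eq_trace_form => A B.
by rewrite /projective mul1r mulN1r mulNr [gm X Y * _]mulrC.
Qed.

(** The terms where P(X,Y) acts on X1, X2, X3 cancel. With V = P(X1,X2)X3 there remain g(P(X,Y)V,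
    X4) and g(V, P(X,Y)X4), whose sum measures the failure of P(X,Y) to be skew-adjoint. *)
Lemma dot_defect X1 X2 X3 X4 X Y :
  gm (projective_dot13 g c (projective_op g c p) p X1 X2 X3 X Y) X4 -
  projective_dot04 g c P p X1 X2 X3 X4 X Y =
  P X Y (projective_op g c p X1 X2 X3) X4 + P X Y X4 (projective_op g c p X1 X2 X3).
Proof.
have gN u v : gm (- u) v = - gm u v by rewrite /metric_at mulNmx mulNmx mxE.
have opP Z1 Z2 Z3 Z4 : gm (projective_op g c p Z1 Z2 Z3) Z4 = P Z1 Z2 Z3 Z4.
  exact: metric_projective_op.
rewrite /projective_dot13 /projective_dot04.
rewrite !(linear_formD _ _ (linear_metric_at X4)) !gN !opP.
rewrite -(opP X1 X2 X3 (projective_op g c p X Y X4)) metric_atC opP.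
move: (P X Y _ X4) (P X Y X4 _) (P _ X2 X3 X4) (P X1 _ X3 X4) (P X1 X2 _ X4).
move=> a b d f h; ring.
Qed.

(** R drops out by skewness in its last two slots. Substituting g for S in the bracket gives 0, so S
    may be replaced by its traceless part. *)
Lemma projective_symmetrized X Y V W : P X Y V W + P X Y W V =
  - (N - 1)^-1 * (E Y V * gm X W - E X V * gm Y W + E Y W * gm X V - E X W * gm Y V).
Proof.
rewrite /projective /traceless_ricci (riemann_skew34 X Y V W).
move: (Rm X Y V W) (Ric Y V) (Ric X V) (Ric Y W) (Ric X W).
move: (gm X W) (gm Y W) (gm X V) (gm Y V).
move: (kap / N) => k x y z w r a b d f; ring.
Qed.

Lemma traceless_ricci_eq0 :
  (forall X1 X2 X3 X Y W, P X Y (projective_op g c p X1 X2 X3) W +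
     P X Y W (projective_op g c p X1 X2 X3) = 0) ->
  forall X Y, E X Y = 0.
Proof.
move=> H.
have sym V X Y W : (exists X1 X2 X3, V = projective_op g c p X1 X2 X3) ->
    E Y V * gm X W - E X V * gm Y W + E Y W * gm X V - E X W * gm Y V = 0.
  move=> [X1 [X2 [X3 ->]]]; have /eqP := H X1 X2 X3 X Y W.
  by rewrite projective_symmetrized mulf_eq0 oppr_eq0 invr_eq0 (negPf N1) => /eqP.
have traceE : trace_form E = 0.
  rewrite (_ : trace_form _ = 1 * trace_form Ric + (- (kap / N)) * trace_form gm).
    by rewrite trace_metric -[trace_form Ric]/kap mul1r mulNr divfK// subrr.
  by rewrite -trace_form_comb; apply: eq_trace_form => X Y; rewrite mul1r mulNr.
(* In the trace of [sym] over X and W the four terms give n E(Y,V), -E(Y,V), E(Y,V) and -g(Y,V) tr E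
   = 0. *)
have EV V Y : (exists X1 X2 X3, V = projective_op g c p X1 X2 X3) -> E Y V = 0.
  move=> VP; have tr1 := trace_metric_form Y (linear_traceless_ricci V).
  have tr2 : trace_form (fun A B => E Y B * gm A V) = E Y V.
    rewrite traceless_ricciC -(trace_metric_form V (linear_traceless_ricci Y)).
    rewrite -trace_formC; apply: eq_trace_form => A B.
    by rewrite (traceless_ricciC Y) metric_atC.
  have tr : trace_form (fun A B => 1 * (E Y V * gm A B + (-1) * (E A V * gm Y B)) +
      1 * (1 * (E Y B * gm A V) + (- gm Y V) * E A B)) = 0.
    rewrite -[RHS](mul0r (trace_form gm)) -trace_formZ; apply: eq_trace_form => A B.
    rewrite mul0r -[RHS](sym V A Y B VP).
    move: (E Y V) (gm A B) (E A V) (gm Y B) (E Y B) (gm A V) (gm Y V) (E A B).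
    move=> x1 x2 x3 x4 x5 x6 x7 x8; ring.
  move: tr; rewrite !trace_form_comb tr1 tr2 traceE trace_metric.
  move=> tr; apply/eqP; have : E Y V * N = 0.
    by rewrite -[RHS]tr; move: (E Y V) => x; ring.
  by move/eqP; rewrite mulf_eq0 (negPf N0) orbF.
(* By [EV] only the last two terms of [sym] survive, and g(X,V) is P(X1,X2,X3,X). *)
have exchange X1 X2 X3 X Y W : E Y W * P X1 X2 X3 X = E X W * P X1 X2 X3 Y.
  have VP : exists Z1 Z2 Z3, projective_op g c p X1 X2 X3 = projective_op g c p Z1 Z2 Z3.
    by exists X1, X2, X3.
  have := sym _ X Y W VP; rewrite !(EV _ _ VP) !mul0r subrr add0r.
  rewrite ![gm _ (projective_op _ _ _ _ _ _)]metric_atC !metric_projective_op//.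
  by move/eqP; rewrite subr_eq0 => /eqP.
(* This is P(eW,X2,X3,Y) = 0, with e expressed as a trace against E: [exchange] is traced over X1
   and X. *)
have contracted W X2 X3 Y : trace_form (fun A B => E B W * P A X2 X3 Y) = 0.
  rewrite -[RHS](mulr0 (E Y W)) -(trace_projective14 X2 X3) -trace_formZ.
  by apply: eq_trace_form => A B; rewrite exchange.
(* This is E(eW,Y) = 0: [contracted] is traced over the two middle slots, the traces are exchanged,
   and the nonzero factor n/(n-1) is cancelled. *)
have isotropic W Y : trace_form (fun A B => E B W * E A Y) = 0.
  have : trace_form (fun C D => trace_form (fun A B => E B W * P A C D Y)) = 0.
    by rewrite -[RHS]trace_form0; apply: eq_trace_form => C D; exact: contracted.
  rewrite (exchange_trace_form (fun C D A B => E B W * P A C D Y)).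
  rewrite (_ : trace_form _ = trace_form (fun A B => N / (N - 1) * (E B W * E A Y))).
    rewrite trace_formZ => /eqP; rewrite !mulf_eq0 invr_eq0 (negPf N0) (negPf N1).
    by move/eqP.
  by apply: eq_trace_form => A B; rewrite trace_formZ trace_projective23 mulrCA.
have diag Z : E Z Z = 0.
  have trZ : trace_form (fun A B => E B Z * gm A Z) = E Z Z.
    rewrite -[RHS](trace_metric_form Z (linear_traceless_ricci Z)) -trace_formC.
    by apply: eq_trace_form => A B; rewrite metric_atC.
  have : trace_form (fun A B =>
      E Z Z * (E B Z * gm A Z) + (- gm Z Z) * (E B Z * E A Z)) = 0.
    rewrite -[RHS](mulr0 (- (N - 1))) -(contracted Z Z Z Z) -trace_formZ.
    (* With both last slots equal to Z the symmetrized formula gives 2 P(A,Z,Z,Z), whence the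
       cancellation of 2. *)
    apply: eq_trace_form => A B; have := projective_symmetrized A Z Z Z.
    move: (P A Z Z Z) (E Z Z) (gm Z Z) (E B Z) (gm A Z) (E A Z) => x z m b a f.
    move=> H2; have -> : x = - (N - 1)^-1 * (z * a - f * m).
      by apply: (mulfI (_ : 2 != 0 :> R)) => //; rewrite mulr2n mulrDl !mul1r H2; ring.
    by field.
  rewrite trace_form_comb trZ isotropic mulr0 addr0 => /eqP.
  by rewrite mulf_eq0 orbb => /eqP.
(* Polarization: E(X+Y,X+Y) = 0 reduces to 2 E(X,Y) = 0. *)
move=> X Y; have := diag (X + Y).
rewrite (linear_formD _ _ (linear_traceless_ricci _)) ![E _ (X + Y)]traceless_ricciC.
rewrite !(linear_formD _ _ (linear_traceless_ricci _)) !diag (traceless_ricciC Y X).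
rewrite addr0 add0r => /eqP; rewrite -mulr2n mulrn_eq0 => /eqP//.
Qed.

End CurvatureAtPoint.

(** * Passage between vector fields and tangent vectors at a point, and the two implications *)

Theorem theorem4p7 (R : realType) (n : nat) (n_ge3 : (3 <= n)%N)
    (M : smooth_manifold R n) (M_connected : connected [set: M])
    (g : semi_riemannian_metric M) :
  (forall X1 X2 X3 X4 X Y : vector_field M,
   forall c : chart R n M, atlas c -> forall p : M, chart_dom c p ->
     metric_at g c p
       (projective_dot13 g c (projective_op g c p) p
          (X1 c p) (X2 c p) (X3 c p) (X c p) (Y c p))
       (X4 c p) =
     projective_dot04 g c (projective g c p) p
       (X1 c p) (X2 c p) (X3 c p) (X4 c p) (X c p) (Y c p))
  <-> einstein g.
Proof.
split=> [H c ac p cp u v|Ein X1 X2 X3 X4 X Y c ac p cp].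
  apply: subr0_eq.
  apply: (traceless_ricci_eq0 ac cp n_ge3) => x1 x2 x3 x y x4.
  have [X1 <-] := vector_field_through x1 ac cp.
  have [X2 <-] := vector_field_through x2 ac cp.
  have [X3 <-] := vector_field_through x3 ac cp.
  have [X4 <-] := vector_field_through x4 ac cp.
  have [X <-] := vector_field_through x ac cp.
  have [Y <-] := vector_field_through y ac cp.
  by rewrite -(dot_defect g ac cp); apply/eqP; rewrite subr_eq0; apply/eqP; exact: H.
have E0 u v : traceless_ricci g c p u v = 0.
  by rewrite /traceless_ricci (Ein c ac p cp u v) subrr.
apply: subr0_eq; rewrite (dot_defect g ac cp) (projective_symmetrized g ac cp).
by rewrite !E0 !mul0r !subrr !(addr0, subr0) mulr0.
Qed.
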